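(* The infinite sequence $\mathrm{cr}^{(0)}=\mathrm{cr},\ \mathrm{cr}^{(1)}=\mathrm{cr}',\ \mathrm{cr}^{(2)}=\mathrm{cr}'',\ \mathrm{cr}^{(3)}=\mathrm{cr}''',\dots$ of functions on the set of ordered quadruples of pairwise distinct points of $\mathbb P^1(\mathbb Q)$ is algebraically independent over $\mathbb C$.
   Context: **$q$-rationals.** $[\,\cdot\,]_q:\mathbb P^1(\mathbb Q)=\mathbb Q\cup\{\infty\}\to\mathbb P^1(\mathbb Q(q))$ is the unique map with $[0]_q=0$, $[x+1]_q=q[x]_q+1$ and $[-1/x]_q=-1/(q[x]_q)$ for all $x$ (usual conventions for $\infty$; in particular $[\infty]_q=\infty$). For finite $x$, $[x]_q$ is a rational function of $q$, regular at $q=1$ with $[x]_1=x$. **Cross-ratios.** For pairwise distinct points of $\mathbb P^1(\mathbb K)$ with nonzero lifts $X_i\in\mathbb K^2$ and $\Delta_{ij}=\det(X_i,X_j)$, $\mathrm{cr}(x_1,x_2;x_3,x_4)=\frac{\Delta_{13}\Delta_{24}}{\Delta_{14}\Delta_{23}}$ (equal to $\frac{(x_1-x_3)(x_2-x_4)}{(x_1-x_4)(x_2-x_3)}$ in finite affine coordinates). For pairwise distinct $x_i\in\mathbb P^1(\mathbb Q)$, $\mathrm{cr}_q(x_1,x_2;x_3,x_4)=\mathrm{cr}([x_1]_q,[x_2]_q;[x_3]_q,[x_4]_q)\in\mathbb Q(q)$. **Taylor coefficients.** The coefficients $\mathrm{cr}^{(n)}$ are the functions of the quadruple defined by the expansion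 at $h=0$, with $q=e^h$: $\mathrm{cr}_{e^h}=\sum_{n\ge0}\mathrm{cr}^{(n)}h^n/n!$. **Algebraic independence.** Functions $J_0,\dots,J_{N-1}$ on a set are algebraically independent over $\mathbb C$ if there is no nonzero polynomial $P\in\mathbb C[T_0,\dots,T_{N-1}]$ such that $P(J_0,\dots,J_{N-1})$ vanishes identically on the set. An infinite sequence $J_0,J_1,\dots$ is algebraically independent if its first $N$ terms are, for every $N$. *)

(* Defs.v *)
From HB Require Import structures.
From mathcomp Require Import all_boot all_order all_algebra.
From mathcomp Require Import generic_quotient fraction ring lra zify.
From mathcomp Require Import complex.
From mathcomp Require Import all_classical all_reals all_analysis.
(* The notations of mpoly clash with those of the analysis library. *)
From mathcomp Require mpoly.
Import (canonicals) mathcomp.multinomials.mpoly.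

Set Implicit Arguments.
Unset Strict Implicit.
Unset Printing Implicit Defensive.
Import Order.TTheory GRing.Theory Num.Theory.
Import numFieldNormedType.Exports.
Local Open Scope ring_scope.

(* None stands for the point at infinity. *)
Definition P1 (K : fieldType) : Type := option K.

Definition P1_affine (K : fieldType) (a b : K) (x : P1 K) : P1 K :=
  omap (fun z => a * z + b) x.

Definition P1_neginv (K : fieldType) (x : P1 K) : P1 K :=
  if x is Some z then (if z == 0 then None else Some (- z^-1)) else Some 0.

Definition P1_lift (K : fieldType) (x : P1 K) : 'cV[K]_2 :=
  if x is Some z then \col_i (if i == 0 then z else 1)
  else \col_i (if i == 0 then 1 else 0).

Definition P1_lift_det (K : fieldType) (X Y : 'cV[K]_2) : K :=
  \det (row_mx X Y : 'M[K]_2).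

Definition cross_ratio (K : fieldType) (x1 x2 x3 x4 : P1 K) : K :=
  let D x y := P1_lift_det (P1_lift x) (P1_lift y) in
  (D x1 x3 * D x2 x4) / (D x1 x4 * D x2 x3).

Lemma P1_lift_detE (K : fieldType) (X Y : 'cV[K]_2) :
  P1_lift_det X Y = X 0 0 * Y 1 0 - Y 0 0 * X 1 0.
Proof.
have E i : row_mx X Y i 0 = X i 0.
  by rewrite mxE; case: splitP => //= j _; rewrite ord1.
have F i : row_mx X Y i 1 = Y i 0.
  by rewrite mxE; case: splitP => [j|j _]; rewrite ord1.
rewrite /P1_lift_det; move: (row_mx X Y : 'M[K]_2) E F => A E F.
rewrite (expand_det_col _ 0) !big_ord_recl big_ord0 addr0.
rewrite /cofactor !det_mx11 !mxE /= !E expr0 expr1 mul1r.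
have -> : lift 0 0 = 1 :> 'I_2 by apply: val_inj.
have -> : lift 1 0 = 0 :> 'I_2 by apply: val_inj.
by rewrite !F; ring.
Qed.

(* The cross-ratio does not depend on the lifts. *)
Lemma cross_ratio_lift (K : fieldType) (x1 x2 x3 x4 : P1 K)
    (X1 X2 X3 X4 : 'cV[K]_2) (k1 k2 k3 k4 : K) :
  k1 != 0 -> X1 = k1 *: P1_lift x1 -> k2 != 0 -> X2 = k2 *: P1_lift x2 ->
  k3 != 0 -> X3 = k3 *: P1_lift x3 -> k4 != 0 -> X4 = k4 *: P1_lift x4 ->
  cross_ratio x1 x2 x3 x4 =
  (P1_lift_det X1 X3 * P1_lift_det X2 X4) /
  (P1_lift_det X1 X4 * P1_lift_det X2 X3).
Proof.
move=> k1N0 -> k2N0 -> k3N0 -> k4N0 ->; rewrite /cross_ratio.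
have Z a b X Y : P1_lift_det (a *: X) (b *: Y) = a * b * P1_lift_det X Y.
  by rewrite !P1_lift_detE !mxE; ring.
rewrite !Z.
set a := P1_lift_det _ _; set b := P1_lift_det _ _.
set c := P1_lift_det _ _; set d := P1_lift_det _ _.
have kN0 : k1 * k2 * k3 * k4 != 0 by rewrite !mulf_neq0.
have -> : k1 * k3 * a * (k2 * k4 * b) = (k1 * k2 * k3 * k4) * (a * b) by ring.
have -> : k1 * k4 * c * (k2 * k3 * d) = (k1 * k2 * k3 * k4) * (c * d) by ring.
by rewrite -[in RHS]mulf_div divff // mul1r.
Qed.

Lemma cross_ratio_affine (K : fieldType) (z1 z2 z3 z4 : K) :
  cross_ratio (Some z1) (Some z2) (Some z3) (Some z4) =
  ((z1 - z3) * (z2 - z4)) / ((z1 - z4) * (z2 - z3)).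
Proof. by rewrite /cross_ratio !P1_lift_detE !mxE /= !mulr1. Qed.

(* The three fields read [0]_q = 0, [x+1]_q = q [x]_q + 1 and
   [-1/x]_q = -1/(q [x]_q), for x in P^1(Q). *)
Record is_q_rational (K : fieldType) (q : K) (f : P1 rat -> P1 K) : Prop := {
  q_rational0 : f (Some 0) = Some 0;
  q_rationalD1 : forall x, f (P1_affine 1 1 x) = P1_affine q 1 (f x);
  q_rational_neginv :
    forall x, f (P1_neginv x) = P1_neginv (P1_affine q 0 (f x)) }.

(* Existence of the map [.]_q, by a subtractive Euclidean algorithm *)
Module QRational.

Definition T (K : fieldType) (q : K) : P1 K -> P1 K := P1_affine q 1.
Definition Ti (K : fieldType) (q : K) : P1 K -> P1 K := P1_affine q^-1 (- q^-1).
Definition S (K : fieldType) (q : K) (x : P1 K) : P1 K :=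
  P1_neginv (P1_affine q 0 x).

Lemma TK (K : fieldType) (q : K) : q != 0 -> cancel (T q) (Ti q).
Proof. by move=> qN0 [z|] //=; congr Some; field; rewrite qN0. Qed.

Lemma TiK (K : fieldType) (q : K) : q != 0 -> cancel (Ti q) (T q).
Proof. by move=> qN0 [z|] //=; congr Some; field; rewrite qN0. Qed.

Lemma SK (K : fieldType) (q : K) : q != 0 -> involutive (S q).
Proof.
move=> qN0 [z|]; rewrite /S /=; last first.
  by rewrite mulr0 addr0 eqxx.
rewrite addr0 mulf_eq0 (negPf qN0) /=; case: eqVneq => [->//|zN0] /=.
rewrite addr0 mulf_eq0 (negPf qN0) oppr_eq0 invr_eq0 mulf_eq0 (negPf qN0).
by rewrite (negPf zN0) /= mulrN invrN opprK invfM invrK mulKf.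
Qed.

Lemma TS (K : fieldType) (q : K) (x : P1 K) : q != 0 ->
  T q (S q x) = if x is Some z then
    (if z == 0 then None else Some (1 - z^-1)) else Some 1.
Proof.
move=> qN0; case: x => [z|]; rewrite /S /=; last by rewrite mulr0 add0r.
rewrite addr0 mulf_eq0 (negPf qN0) /=; case: eqVneq => //= zN0.
by congr Some; field; rewrite zN0 qN0.
Qed.

Lemma TST (K : fieldType) (q : K) (x : P1 K) : q != 0 ->
  T q (S q (T q x)) = S q (Ti q (S q x)).
Proof.
move=> qN0.
have R3 z : T q (S q (T q (S q (T q (S q z))))) = z.
  rewrite !TS //; case: z => [z|] /=; last by rewrite oner_eq0 invr1 subrr eqxx.
  case: eqVneq => [->|zN0] /=; first by rewrite oner_eq0 invr1 subrr.
  have -> : (1 - z^-1 == 0) = (z == 1).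
    by rewrite subr_eq0 eq_sym invr_eq1.
  case: eqVneq => [->|zN1] //=.
  have z1N0 : z - 1 != 0 by rewrite subr_eq0.
  have -> : 1 - (1 - z^-1)^-1 = - (z - 1)^-1.
    by field; rewrite z1N0 zN0.
  by rewrite oppr_eq0 invr_eq0 (negPf z1N0); congr Some; rewrite invrN invrK; ring.
by have := R3 (S q x); rewrite SK // => /(canRL (TK qN0)) /(canRL (SK qN0)).
Qed.


Fixpoint G (K : fieldType) (q : K) (n a b : nat) : P1 K :=
  if n is m.+1 then
    if a == b then Some 1
    else if (b < a)%N then T q (G q m (a - b) b)
    else S q (Ti q (S q (G q m a (b - a))))
  else None.

Lemma G_eq (K : fieldType) (q : K) n m a b c d :
  (0 < a)%N -> (0 < b)%N -> (0 < c)%N -> (0 < d)%N ->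
  (a + b <= n)%N -> (c + d <= m)%N -> (a * d = c * b)%N ->
  G q n a b = G q m c d.
Proof.
elim: n m a b c d => [|n IH] [|m] a b c d a0 b0 c0 d0 abn cdm e; try lia.
rewrite /=; have -> : (c == d) = (a == b) by apply/eqP/eqP; nia.
have -> : (d < c)%N = (b < a)%N by apply/idP/idP; nia.
case: eqP => // /eqP ab; case: ltnP => ba; first by rewrite (IH m _ _ (c - d)%N d) //; nia.
by rewrite (IH m _ _ c (d - c)%N) //; nia.
Qed.

Definition gp (K : fieldType) (q : K) (x : rat) : P1 K :=
  G q (`|numq x| + `|denq x|)%N `|numq x|%N `|denq x|%N.

Lemma gpE (K : fieldType) (q : K) n a b :
  (0 < a)%N -> (0 < b)%N -> (a + b <= n)%N ->
  gp q (a%:R / b%:R) = G q n a b.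
Proof.
move=> a0 b0 abn; rewrite /gp; set x : rat := _ / _.
have x0 : 0 < x by rewrite divr_gt0 ?ltr0n.
have nx : 0 < numq x by rewrite numq_gt0.
apply: G_eq => //; rewrite ?absz_gt0 ?denq_neq0 ?gt_eqF //.
have b0' : b%:R != 0 :> rat by rewrite pnatr_eq0; lia.
have d0' : (denq x)%:~R != 0 :> rat by rewrite intr_eq0 denq_neq0.
have : (numq x)%:~R * b%:R = a%:R * (denq x)%:~R :> rat.
  have := divq_num_den x; rewrite {3}/x => /eqP.
  by rewrite eqr_div // => /eqP.
rewrite !pmulrn -!intrM.
move=> /eqP; rewrite eqr_int => /eqP e.
have dx := denq_gt0 x; lia.
Qed.

Lemma posratP (x : rat) : 0 < x ->
  exists a b, [/\ (0 < a)%N, (0 < b)%N & x = a%:R / b%:R].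
Proof.
move=> x0; exists `|numq x|%N, `|denq x|%N.
rewrite !absz_gt0 denq_neq0 gt_eqF ?numq_gt0 //; split => //.
by rewrite !natr_absz !gtr0_norm ?numq_gt0 ?denq_gt0 // divq_num_den.
Qed.

Lemma gp1 (K : fieldType) (q : K) : gp q 1 = Some 1.
Proof. by have := @gpE K q 2 1 1 isT isT isT; rewrite !mulr1n divr1. Qed.

Lemma gpD1 (K : fieldType) (q : K) x : 0 < x -> gp q (x + 1) = T q (gp q x).
Proof.
move=> /posratP [a [b [a0 b0 ->]]].
have b0' : b%:R != 0 :> rat by rewrite pnatr_eq0; lia.
have -> : a%:R / b%:R + 1 = (a + b)%:R / b%:R :> rat by rewrite natrD; field.
rewrite (@gpE _ _ (a + b + b).+1) ?addn_gt0 ?a0 //= (@gpE _ _ (a + b + b)) //; try lia.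
by rewrite addnK ifF ?ifT //; lia.
Qed.

Lemma gpV (K : fieldType) (q : K) x : 0 < x ->
  gp q (x / (x + 1)) = S q (Ti q (S q (gp q x))).
Proof.
move=> /posratP [a [b [a0 b0 ->]]].
have b0' : b%:R != 0 :> rat by rewrite pnatr_eq0; lia.
have ab0 : a%:R + b%:R != 0 :> rat by rewrite -natrD pnatr_eq0; lia.
have -> : a%:R / b%:R / (a%:R / b%:R + 1) = a%:R / (a + b)%:R :> rat.
  by rewrite natrD; field; rewrite ab0 b0'.
rewrite (@gpE _ _ (a + b + a).+1) ?addn_gt0 ?a0 //= ?(@gpE _ _ (a + b + a)) //; try lia.
by rewrite addKn ifF ?ifF //; lia.
Qed.

Definition f (K : fieldType) (q : K) (x : P1 rat) : P1 K :=
  if x is Some z then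
    if z == 0 then Some 0 else if 0 < z then gp q z else S q (gp q (- z^-1))
  else None.

Lemma fP (K : fieldType) (q : K) : q != 0 -> is_q_rational q (f q).
Proof.
move=> qN0; split=> [|[x|]|[x|]] //=; rewrite ?eqxx //.
- rewrite mul1r -/(T q _); case: (ltgtP 0 x) => [x0|x0|<-].
  + have x1 : 0 < x + 1 by lra.
    by rewrite gt_eqF // x1 gpD1.
  + have xN0 : x != 0 by rewrite lt_eqF.
    set y := - x^-1; have y0 : 0 < y by rewrite oppr_gt0 invr_lt0.
    have xE : x = - y^-1 by rewrite /y invrN invrK opprK.
    have yN0 : y != 0 by rewrite gt_eqF.
    case: (ltgtP 0 (x + 1)) => [x1|x1|x1].
    * have y1 : 0 < y - 1.
        rewrite subr_gt0 /y -invrN invf_gt1 ?oppr_gt0 //; lra.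
      have -> : gp q y = T q (gp q (y - 1)) by rewrite -gpD1 ?subrK.
      rewrite TST // -gpV // subrK; congr gp.
      by rewrite xE; field.
    * set w := - (x + 1)^-1.
      have w0 : 0 < w by rewrite oppr_gt0 invr_lt0.
      have x1N0 : x + 1 != 0 by rewrite lt_eqF.
      have -> : y = w / (w + 1).
        have -> : w + 1 = x / (x + 1).
          by rewrite /w -[X in _ + X](divff x1N0) -mulN1r -mulrDl addrC addrK.
        by rewrite invfM invrK /w mulrCA mulNr mulVf // mulrN1.
      by rewrite gpV // SK // TiK.
    * have -> : y = 1 by rewrite /y; have -> : x = -1 by lra.
      by rewrite gp1 TS // oner_eq0 invr1 subrr.
  + by rewrite add0r oner_eq0 ltr01 gp1 /T /= mulr0 add0r.
- case: eqVneq => [_|xN0] /=; rewrite -/(S q _).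
    by rewrite /S /= !(mulr0, addr0) eqxx.
  rewrite oppr_eq0 invr_eq0 (negPf xN0) oppr_gt0 invr_lt0.
  have : (0 < x) || (x < 0) by rewrite orbC -neq_lt.
  case/orP => x0; rewrite x0 ?(lt_gtF x0).
    by rewrite invrN invrK opprK.
  by rewrite SK.
Qed.

End QRational.

Lemma q_rational_exists (K : fieldType) (q : K) :
  q != 0 -> exists f, is_q_rational q f.
Proof. by move=> qN0; exists (QRational.f q); apply: QRational.fP. Qed.

Lemma q_rational_unique (K : fieldType) (q : K) (f g : P1 rat -> P1 K) :
  q != 0 -> is_q_rational q f -> is_q_rational q g -> f =1 g.
Proof.
move=> qN0 fP gP.
have f0 := q_rational0 fP; have g0 := q_rational0 gP.
have fS := q_rational_neginv fP; have gS := q_rational_neginv gP.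
have fT := q_rationalD1 fP; have gT := q_rationalD1 gP.
have HT x : f (P1_affine 1 1 x) = g (P1_affine 1 1 x) -> f x = g x.
  by rewrite fT gT => /(can_inj (QRational.TK qN0)).
have HS x : f (P1_neginv x) = g (P1_neginv x) -> f x = g x.
  by rewrite fS gS => /(can_inj (QRational.SK qN0)).
have pos n a b : (0 < a)%N -> (0 < b)%N -> (a + b <= n)%N ->
    f (Some (a%:R / b%:R)) = g (Some (a%:R / b%:R)).
  elim: n a b => [|n IH] a b a0 b0 abn; first by lia.
  have a0' : a%:R != 0 :> rat by rewrite pnatr_eq0; lia.
  have b0' : b%:R != 0 :> rat by rewrite pnatr_eq0; lia.
  case: (ltngtP a b) => [ab|ab|->]; last first.
  - rewrite divff //.
    have -> : Some 1 = P1_affine 1 1 (Some 0) :> P1 rat.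
      by rewrite /= mulr0 add0r.
    by rewrite fT gT f0 g0.
  - have -> : Some (a%:R / b%:R) =
        P1_affine 1 1 (Some ((a - b)%:R / b%:R)) :> P1 rat.
      by rewrite /=; congr Some; rewrite natrB 1?ltnW //; field.
    by rewrite fT gT IH //; lia.
  - apply: (HS); apply: (HT).
    have ab0 : a%:R - b%:R != 0 :> rat by rewrite subr_eq0 eqr_nat; lia.
    have -> : P1_affine 1 1 (P1_neginv (Some (a%:R / b%:R))) =
        P1_neginv (Some (a%:R / (b - a)%:R)) :> P1 rat.
      rewrite /= !mulf_eq0 !invr_eq0 (negPf a0') (negPf b0') /=.
      have -> : ((b - a)%:R == 0 :> rat) = false.
        by rewrite pnatr_eq0; lia.
      rewrite /=; congr Some; rewrite natrB 1?ltnW //.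
      by field; rewrite a0' -opprB oppr_eq0 ab0.
    by rewrite fS gS IH //; lia.
have pos' x : 0 < x -> f (Some x) = g (Some x).
  by move=> /QRational.posratP [a [b [a0 b0 ->]]]; apply: (pos (a + b)%N).
case=> [x|]; last by apply: HS; rewrite /= f0 g0.
case: (ltgtP 0 x) => [/pos' //|x0|<-]; last by rewrite f0 g0.
apply: HS; rewrite /= lt_eqF //; apply: pos'.
by rewrite oppr_gt0 invr_lt0.
Qed.

Definition Qq : fieldType := {fraction {poly rat}}.

Definition Qq_q : Qq := FracField.tofrac 'X.

Lemma Qq_q_neq0 : Qq_q != 0.
Proof. by rewrite tofrac_eq0 polyX_eq0. Qed.

Definition q_rational : P1 rat -> P1 Qq := sval (cid (q_rational_exists Qq_q_neq0)).

Lemma q_rationalP : is_q_rational Qq_q q_rational.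
Proof. exact: svalP (cid (q_rational_exists Qq_q_neq0)). Qed.

Definition cr_q (x1 x2 x3 x4 : P1 rat) : Qq :=
  cross_ratio (q_rational x1) (q_rational x2) (q_rational x3) (q_rational x4).

(* Specialization of a rational function at a real number. The representative
   of a fraction need not be reduced, hence the division by the gcd. *)
Definition ratfun_eval (R : realType) (F : Qq) (x : R) : R :=
  let n := (frac (repr F)).1 in
  let d := (frac (repr F)).2 in
  let g := gcdp n d in
  (map_poly ratr (n %/ g)).[x] / (map_poly ratr (d %/ g)).[x].

Lemma ratfun_evalE (R : realType) (n d : {poly rat}) (x : R) :
  (map_poly ratr d).[x] != 0 ->
  ratfun_eval (FracField.tofrac n / FracField.tofrac d) x =
  (map_poly ratr n).[x] / (map_poly ratr d).[x].
Proof.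
move=> dxN0.
have dN0 : d != 0 by apply: contraNneq dxN0 => ->; rewrite rmorph0 horner0.
rewrite /ratfun_eval; set F : Qq := FracField.tofrac n / FracField.tofrac d.
set n0 := (frac (repr F)).1; set d0 := (frac (repr F)).2; set g := gcdp n0 d0.
have d0N0 : d0 != 0 by apply: denom_ratioP.
have FE : F * FracField.tofrac d0 = FracField.tofrac n0.
  rewrite /n0 /d0; clearbody F; clear; rewrite -{1}[F]reprK.
  move: (repr F) => r; rewrite !piE; apply/eqP; rewrite piE.
  rewrite /FracField.equivf /FracField.mulf.
  rewrite !numden_Ratio ?mulf_neq0 ?oner_neq0 ?denom_ratioP //.
  by rewrite !mulr1 mulrC.
have e : n0 * d = n * d0.
  apply/eqP; rewrite -tofrac_eq !tofracM -FE /F mulrAC divfK //.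
  by rewrite tofrac_eq0.
have gN0 : g != 0 by rewrite gcdp_eq0 (negPf d0N0) andbF.
have n0E : n0 = (n0 %/ g) * g by rewrite divpK // dvdp_gcdl.
have d0E : d0 = (d0 %/ g) * g by rewrite divpK // dvdp_gcdr.
set n1 := n0 %/ g in n0E *; set d1 := d0 %/ g in d0E *.
have e1 : n1 * d = n * d1.
  by apply: (mulIf gN0); rewrite mulrAC -n0E e -mulrA -d0E.
have cop : coprimep d1 n1.
  by rewrite coprimep_sym /n1 /d1 coprimep_div_gcd // d0N0 orbT.
have d1d : d1 %| d.
  by rewrite -(Gauss_dvdpr _ cop) e1 dvdp_mull.
have [u dE] : exists u, d = u * d1 by exists (d %/ d1); rewrite divpK.
have d1N0 : d1 != 0 by apply: contraNneq dN0 => d10; rewrite dE d10 mulr0.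
have nE : n = u * n1.
  by apply: (mulIf d1N0); rewrite -e1 dE mulrCA mulrA.
move: dxN0; rewrite nE dE !rmorphM !hornerM mulf_eq0 negb_or => /andP[u0 v0].
by rewrite -mulf_div divff // mul1r.
Qed.

Definition quadruple : Type := {x : 4.-tuple (P1 rat) | uniq x}.

Definition cr_quad (X : quadruple) : Qq :=
  let x := val X in
  cr_q (tnth x 0) (tnth x 1) (tnth x 2) (tnth x 3).

(* The coefficient of h^n / n! in the Taylor expansion of cr_q at q = e^h
   around h = 0, that is, the n-th derivative at 0. The rational function
   cr_q is regular at q = 1, so the conventional value of ratfun_eval at a
   pole plays no role. *)
Definition cr_taylor (R : realType) (n : nat) (X : quadruple) : R :=
  derive1n n (fun h : R => ratfun_eval (cr_quad X) (expR h)) 0.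

Definition alg_independent (C : fieldType) (A : Type) (N : nat)
    (J : 'I_N -> A -> C) : Prop :=
  ~ exists P : mpoly.mpoly N C,
    P != 0 /\ forall a : A, mpoly.meval (fun i => J i a) P = 0.

Definition alg_independent_seq (C : fieldType) (A : Type)
    (J : nat -> A -> C) : Prop :=
  forall N : nat, alg_independent (fun i : 'I_N => J i).

(* Main.v *)
Require Import Defs.
From mathcomp Require Import all_boot all_order all_algebra.
From mathcomp Require Import fraction complex ring lra zify.
From mathcomp Require mpoly.

(* The quadruple [(oo, 0; 1, x)] has q-cross-ratio [[x]_q], so it is enough to
   treat the jets at [h = 0] of the functions [[x]_q], [q = e^h], [x] rational.
   Let [I] be the space of polynomials vanishing on all these jets. The maps
   [x -> x + n] and [x -> x / (1 - n x)] act on jets rationally in [n]; hence [I]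
   is preserved by the derivatives of these actions at [n = 0], which are the
   vector fields [A = beta + eta y] and [B = q beta y^2 - eta y], where
   [eta = log q] and [beta = eta / (q - 1)], and then by the Lie algebra they
   generate. With [D = [A, B]] one has [[D, [D, A]] = mu A], where
   [mu = 4 kappa (kappa + eta^2)], [kappa = q beta^2]. Since [mu - 4] has order
   exactly 2 in [h], the fields [(mu - 4)^k A] and [(mu - 4)^k D] take at the jet
   [0 = [0]_q] values of order [2k] and [2k + 1]: they span all directions.
   Lowering the order of vanishing at [0] along these fields shows [I = 0]. *)

Set Implicit Arguments.
Unset Strict Implicit.
Unset Printing Implicit Defensive.
Import Order.TTheory GRing.Theory Num.Theory.
Local Open Scope ring_scope.

(** * Congruences of polynomials modulo powers of ['X] *)

Lemma eq_coefMl (A : nzRingType) N (p p' r : {poly A}) :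
  (forall k, (k < N)%N -> p`_k = p'`_k) ->
  forall k, (k < N)%N -> (p * r)`_k = (p' * r)`_k.
Proof.
move=> e k kN; rewrite !coefM; apply: eq_bigr => i _.
by rewrite e // (leq_ltn_trans _ kN) // -ltnS.
Qed.

Section ModXn.
Variable C : fieldType.

Definition eq_modX N (p r : {poly C}) : Prop := exists k, p = r + 'X ^+ N * k.

Lemma eq_modXP N p r : eq_modX N p r <-> forall k, (k < N)%N -> p`_k = r`_k.
Proof.
split=> [[u ->] k kN|e]; first by rewrite coefD coefXnM kN addr0.
exists (drop_poly N (p - r)); apply/polyP => k.
rewrite coefD coefXnM coef_drop_poly coefB; case: ltnP => kN; first by rewrite e // addr0.
by rewrite subnK // addrC subrK.
Qed.

(** A polynomial with nonzero constant term is coprime to ['X ^+ M], so a Bezout coefficient is an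
    inverse. Polynomials modulo ['X ^+ M] thus serve as truncated power series in [h]. *)
Lemma eq_modX_inv M (p : {poly C}) : p.[0] != 0 -> exists r, eq_modX M (p * r) 1.
Proof.
move=> p0; have : coprimep p ('X ^+ M).
  by apply: coprimep_expr; rewrite -['X]subr0 -polyC0 coprimep_XsubC.
case/Bezout_eq1_coprimepP => -[u v] /= <-.
by exists u, (- v); ring.
Qed.

Lemma eq_modX_cancel M (p r s : {poly C}) : p.[0] != 0 -> eq_modX M (r * p) (s * p) ->
  eq_modX M r s.
Proof.
move=> /(eq_modX_inv M)[u [k uE]] [l lE].
exists (l * u - (r - s) * k).
transitivity (r * p * u - r * ('X ^+ M * k)); first by rewrite -mulrA uE; ring.
transitivity (s * (p * u) + 'X ^+ M * (l * u - r * k)); first by rewrite lE; ring.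
by rewrite uE; ring.
Qed.

End ModXn.

Lemma eq_modX_leq (K : fieldType) N M (p r : {poly K}) :
  (N <= M)%N -> eq_modX M p r -> eq_modX N p r.
Proof.
by move=> NM /eq_modXP e; apply/eq_modXP => k kN; apply: e; apply: leq_trans NM.
Qed.

Lemma eq_modX_map (K L : fieldType) (f : {rmorphism K -> L}) M (p r : {poly K}) :
  eq_modX M p r -> eq_modX M (map_poly f p) (map_poly f r).
Proof. by move=> /eq_modXP e; apply/eq_modXP => k kM; rewrite !coef_map e. Qed.

(** * Polynomial vector fields on the space of jets *)

Section VectorFields.
Import mpoly.
Local Open Scope ring_scope.
Variables (C : numFieldType) (N : nat).

Let lft (p : {poly C}) : {poly {mpoly C[N]}} := map_poly (@mpolyC N C) p.

(* The variable ['X_i] stands for the [i]-th derivative at [h = 0], so that it is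
   [i!] times a coefficient. *)
Definition generic_jet : {poly {mpoly C[N]}} :=
  \sum_(i < N) ((i`!%:R^-1 : C) *: 'X_i : {mpoly C[N]}) *: 'X^i.

(* [(a0, a1, a2)] is the vector field [y' = a0 + a1 y + a2 y^2] on jets [y]. *)
Definition vfield : Type := ({poly C} * {poly C} * {poly C})%type.

Definition vf_eval (v : vfield) : {poly {mpoly C[N]}} :=
  lft v.1.1 + lft v.1.2 * generic_jet + lft v.2 * generic_jet ^+ 2.

(** The derivation of the polynomial ring that follows jets moving along [v]; the factor [i!]
    matches the normalization of [generic_jet]. *)
Definition vf_der (v : vfield) (P : {mpoly C[N]}) : {mpoly C[N]} :=
  \sum_(i < N) ((i`!%:R : C) *: (vf_eval v)`_i) * P^`M(i).

(** Coefficients of [v w' - w v'], with derivatives taken in [y]; the cubic terms cancel. *)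
Definition vf_bracket (v w : vfield) : vfield :=
  (v.1.1 * w.1.2 - v.1.2 * w.1.1, 2%:R * (v.1.1 * w.2 - v.2 * w.1.1),
   v.1.2 * w.2 - v.2 * w.1.2).

Definition vf_scale (f : {poly C}) (v : vfield) : vfield :=
  (f * v.1.1, f * v.1.2, f * v.2).

Lemma vf_der_linear v c P Q : vf_der v (c *: P + Q) = c *: vf_der v P + vf_der v Q.
Proof.
rewrite /vf_der scaler_sumr -big_split /=; apply: eq_bigr => i _.
by rewrite mderivD mderivZ mulrDr scalerAr.
Qed.

Lemma vf_derD v P Q : vf_der v (P + Q) = vf_der v P + vf_der v Q.
Proof. by have := vf_der_linear v 1 P Q; rewrite !scale1r. Qed.

Lemma vf_der0 v : vf_der v 0 = 0.
Proof. by rewrite /vf_der big1 // => i _; rewrite mderiv0 mulr0. Qed.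

Lemma vf_der_sum v (I : Type) (r : seq I) (F : I -> {mpoly C[N]}) :
  vf_der v (\sum_(i <- r) F i) = \sum_(i <- r) vf_der v (F i).
Proof. exact: (big_morph _ (vf_derD v) (vf_der0 v)). Qed.

Lemma vf_derZ v c P : vf_der v (c *: P) = c *: vf_der v P.
Proof. by have := vf_der_linear v c P 0; rewrite !addr0 vf_der0 addr0. Qed.

Lemma vf_derM v P Q : vf_der v (P * Q) = vf_der v P * Q + P * vf_der v Q.
Proof.
rewrite /vf_der mulr_suml mulr_sumr -big_split /=; apply: eq_bigr => i _.
by rewrite mderivM; ring.
Qed.

Lemma vf_derX v (i : 'I_N) : vf_der v 'X_i = (i`!%:R : C) *: (vf_eval v)`_i.
Proof.
rewrite /vf_der (bigD1 i) //= big1 => [|j ji]; last first.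
  by rewrite mderivX mnm1E eq_sym (negPf ji) scale0r mulr0.
rewrite addr0 mderivX mnm1E eqxx scale1r (_ : _ - _ = 0)%MM ?mpolyX0 ?mulr1 //.
by apply/mnmP => j; rewrite mnmBE subnn mnm0E.
Qed.

Lemma vf_derC v c : vf_der v c%:MP = 0.
Proof. by rewrite /vf_der big1 // => i _; rewrite mderivC mulr0. Qed.

Let dcoef v (p : {poly {mpoly C[N]}}) := map_poly (vf_der v) p.

Let dcoefE v p k : (dcoef v p)`_k = vf_der v p`_k.
Proof. by rewrite coef_map_id0 ?vf_der0. Qed.

Let dcoefD v p r : dcoef v (p + r) = dcoef v p + dcoef v r.
Proof. by apply/polyP => k; rewrite coefD !dcoefE coefD vf_derD. Qed.

Let dcoefM v p r : dcoef v (p * r) = dcoef v p * r + p * dcoef v r.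
Proof.
apply/polyP => k; rewrite coefD dcoefE !coefM vf_der_sum -big_split /=.
by apply: eq_bigr => i _; rewrite vf_derM !dcoefE.
Qed.

Let dcoefC v p : dcoef v (lft p) = 0.
Proof. by apply/polyP => k; rewrite dcoefE coef_map vf_derC coef0. Qed.

Lemma coef_generic_jet (i : 'I_N) : generic_jet`_i = (i`!%:R^-1 : C) *: 'X_i.
Proof.
rewrite coef_sum (bigD1 i) //= coefZ coefXn eqxx mulr1 big1 ?addr0 // => j ji.
by rewrite coefZ coefXn eq_sym -(inj_eq val_inj) in ji *; rewrite (negPf ji) mulr0.
Qed.

Let dcoef_jet v k : (k < N)%N -> (dcoef v generic_jet)`_k = (vf_eval v)`_k.
Proof.
move=> kN; rewrite dcoefE (coef_generic_jet (Ordinal kN)) vf_derZ vf_derX.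
by rewrite scalerA mulVf ?scale1r //= pnatr_eq0 -lt0n fact_gt0.
Qed.

Let vf_der_eval v w k : (k < N)%N -> vf_der v (vf_eval w)`_k =
  (vf_eval v * (lft w.1.2 + 2%:R * lft w.2 * generic_jet))`_k.
Proof.
move=> kN; rewrite -dcoefE /vf_eval !dcoefD expr2 !dcoefM !dcoefC !mul0r !add0r.
(* Coefficients of index below [N] of a product involve only such coefficients of its factors, and
   there the derivative of the generic jet is [vf_eval v]. *)
rewrite -(eq_coefMl (N := N) _ (@dcoef_jet v)) //.
by congr (nth _ (polyseq _) _); ring.
Qed.

(** The second-order terms cancel because partial derivatives commute; only the derivatives of the
    coefficients of the two fields remain. *)
Lemma vf_der_bracket v w P :
  vf_der v (vf_der w P) - vf_der w (vf_der v P) = vf_der (vf_bracket v w) P.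
Proof.
have E u u' : vf_der u (vf_der u' P) =
    (\sum_(i < N) ((i`!%:R : C) *: vf_der u (vf_eval u')`_i) * P^`M(i)) +
    \sum_(i < N) \sum_(j < N) (((i`!%:R : C) *: (vf_eval u')`_i) *
       ((j`!%:R : C) *: (vf_eval u)`_j)) * P^`M(i)^`M(j).
  rewrite {2}/vf_der vf_der_sum -big_split /=; apply: eq_bigr => i _.
  rewrite vf_derM vf_derZ; congr (_ + _).
  by rewrite [vf_der u (P^`M(i))]/vf_der mulr_sumr; apply: eq_bigr => j _; ring.
rewrite !E [X in _ - (_ + X)]exchange_big /=.
rewrite opprD addrACA [X in _ + X](_ : _ = 0) ?addr0; last first.
  apply/eqP; rewrite subr_eq0; apply/eqP; apply: eq_bigr => i _.
  by apply: eq_bigr => j _; rewrite mderiv_comm; ring.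
rewrite -sumrB; apply: eq_bigr => i _; rewrite -mulrBl -scalerBr.
congr (_ *: _ * _); rewrite !vf_der_eval // -coefB; congr (nth _ (polyseq _) _).
rewrite /vf_bracket /vf_eval /lft /= !(rmorphB, rmorphM) /= rmorph_nat.
by ring.
Qed.

End VectorFields.

(** * Spaces of polynomials stable under vector fields *)

Section StableSubspaces.
Import mpoly.
Local Open Scope ring_scope.
Variables (C : numFieldType) (N : nat) (I : {mpoly C[N]} -> Prop).
Hypothesis I_lin : forall c P Q, I P -> I Q -> I (c *: P + Q).

Definition vf_stable (v : vfield C) : Prop := forall P, I P -> I (vf_der v P).

Definition vf_lin c (v w : vfield C) : vfield C :=
  (c *: v.1.1 + w.1.1, c *: v.1.2 + w.1.2, c *: v.2 + w.2).

Lemma vf_stable_lin c v w :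
  vf_stable v -> vf_stable w -> vf_stable (vf_lin c v w).
Proof.
move=> vI wI P IP; suff -> : vf_der (vf_lin c v w) P = c *: vf_der v P + vf_der w P.
  exact: I_lin (vI _ IP) (wI _ IP).
rewrite /vf_der scaler_sumr -big_split; apply: eq_bigr => i _ /=.
have -> : vf_eval N (vf_lin c v w) = c%:MP%:P * vf_eval N v + vf_eval N w.
  by rewrite /vf_eval /= !(rmorphD, linearZ) /= -!mul_polyC !rmorphM /= !map_polyC /=; ring.
by rewrite coefD coefCM scalerDr mulrDl mul_mpolyC !scalerA -!scalerAl !scalerA [c * _]mulrC.
Qed.

Lemma vf_stable_bracket v w :
  vf_stable v -> vf_stable w -> vf_stable (vf_bracket v w).
Proof.
move=> vI wI P IP; rewrite -vf_der_bracket addrC -scaleN1r.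
apply: I_lin; first by apply/wI/vI.
by apply/vI/wI.
Qed.

(** Any nonconstant monomial of [g] would have to meet a monomial of [Q] of degree below that of
    [m]. *)
Lemma mcoeffM_lowest (g Q : {mpoly C[N]}) m :
  (forall m', (mdeg m' < mdeg m)%N -> Q@_m' = 0) ->
  (g * Q)@_m = g@_0 * Q@_m.
Proof.
move=> Q0; rewrite -{1}[g](subrK (g@_0)%:MP) mulrDl mcoeffD mcoeffCM.
rewrite [X in X + _](_ : _ = 0) ?add0r // mcoeffM big1 // => k /eqP mE.
have [k0|k0] := eqVneq (k.1 : 'X_{1..N}) 0%MM.
  by rewrite k0 mcoeffB mcoeffC eqxx mulr1 subrr mul0r.
rewrite Q0 ?mulr0 //; rewrite [X in (_ < X)%N](congr1 (@mdeg N) mE).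
by rewrite mdegD -[X in (X < _)%N]add0n ltn_add2r lt0n mdeg_eq0.
Qed.

(** At the zero jet only the term of degree 0 in [y] of the field survives. This is why the spanning
    condition below bears on [v.1.1] alone. *)
Lemma vf_eval_coef0 (v : vfield C) k : ((vf_eval N v)`_k)@_0 = v.1.1`_k.
Proof.
have Y0 i : ((generic_jet C N)`_i)@_0 = 0.
  rewrite coef_sum raddf_sum big1 // => j _.
  rewrite coefZ coefXn /=; case: (_ == _); last by rewrite mulr0 raddf0.
  by rewrite mulr1 mcoeffZ mcoeffX mnm1_eq0 mulr0.
have YM (p r : {poly {mpoly C[N]}}) : (forall i, (r`_i)@_0 = 0) ->
    forall i, ((p * r)`_i)@_0 = 0.
  move=> r0 i; rewrite coefM raddf_sum big1 // => j _.
  by rewrite /= (mcoeff0_is_multiplicative N C).1 r0 mulr0.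
rewrite /vf_eval !coefD !mcoeffD !YM // ?addr0; last by move=> i; rewrite expr2 YM.
by rewrite coef_map mcoeffC eqxx mulr1.
Qed.

(* The lowest-degree part of an element of [I] would be lowered by a stable
   vector field until it becomes a nonzero constant. *)
Lemma stable_subspace_eq0 :
  (forall P, I P -> P@_0 = 0) ->
  (forall i : 'I_N, exists2 v, vf_stable v &
     forall k : 'I_N, v.1.1`_k = (k == i)%:R) ->
  forall P, I P -> P = 0.
Proof.
move=> I0 Iv; suff H d : forall P, I P -> forall m, mdeg m = d -> P@_m = 0.
  by move=> P IP; apply/mpolyP => m; rewrite mcoeff0 (H (mdeg m)).
have [n] := ubnP d; elim: n d => // n IH [_ P IP m|d dn P IP m md].
  by move/eqP; rewrite mdeg_eq0 => /eqP ->; apply: I0.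
have [i mi] : exists i, m i != 0%N.
  apply/existsP; rewrite -negb_forall; apply/negP => /forallP m0.
  suff m0' : m = 0%MM by rewrite m0' mdeg0 in md.
  by apply/mnmP => i; rewrite mnm0E; apply/eqP.
have mE : (m - U_(i) + U_(i) = m)%MM.
  by apply/submK/mnm_lepP => j; rewrite mnm1E; case: eqP => // <-; rewrite lt0n.
have md' : mdeg (m - U_(i))%MM = d.
  by move: md; rewrite -{1}mE mdegD mdeg1 addn1 => -[].
have Plow m' : (mdeg m' <= d)%N -> P@_m' = 0.
  by move=> m'd; apply: (IH (mdeg m')) => //; apply: leq_ltn_trans m'd _.
have [v vI vE] := Iv i.
(* The coefficient of [m - U_(i)] in [vf_der v P] is zero by induction. By the choice of [v] only
   the summand [i] contributes to it, with value [i!] times [m i] times the coefficient of [m] in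
   [P]. *)
have := IH d dn _ (vI _ IP) _ md'; rewrite raddf_sum (bigD1 i) //= big1 => [|j ji].
  rewrite addr0 /= mcoeffM_lowest => [|m' m'd]; last first.
    by rewrite mcoeff_deriv Plow ?mul0rn // mdegD mdeg1 addn1 -md'.
  rewrite mcoeffZ vf_eval_coef0 vE eqxx mulr1 mcoeff_deriv mE => /eqP.
  rewrite mulf_eq0 pnatr_eq0 -leqn0 leqNgt fact_gt0 /= mulrn_eq0 /=.
  by move/eqP.
rewrite /= mcoeffM_lowest => [|m' m'd]; last first.
  by rewrite mcoeff_deriv Plow ?mul0rn // mdegD mdeg1 addn1 -md'.
by rewrite mcoeffZ vf_eval_coef0 vE (negPf ji) mulr0 mul0r.
Qed.

(** * The Lie algebra generated by the fields [A] and [B] *)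

Section TwoGenerators.
Variables (q beta eta eta1 mu1 : {poly C}).
Let A : vfield C := (beta, eta, 0).
Let B : vfield C := (0, - eta, q * beta).
Let kappa : {poly C} := q * beta ^+ 2.
Hypotheses (A_stable : vf_stable A) (B_stable : vf_stable B).
Hypotheses (beta0 : beta`_0 != 0) (etaE : eta = 'X * eta1) (eta10 : eta1`_0 != 0).
Hypotheses (muE : 4%:R * kappa * (kappa + eta ^+ 2) - 4%:R = 'X ^+ 2 * mu1)
  (mu10 : mu1`_0 != 0).

(* [ad [A, B]] acts on the span of [A] and [B] with square
   [4 kappa (kappa + eta^2)]. *)
Lemma stable_scaleA k : vf_stable (vf_scale (('X ^+ 2 * mu1) ^+ k) A).
Proof.
elim: k => [|k IHk].
  by have -> : vf_scale (('X ^+ 2 * mu1) ^+ 0) A = A by rewrite /vf_scale expr0 !mul1r.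
set f := _ ^+ k in IHk; set D := vf_bracket A B.
have DI : vf_stable D by apply: vf_stable_bracket.
(* Polynomials in [h] are constants for the bracket, so with [f A] stable, [[D, [D, f A]] - 4 f A =
   (mu - 4) f A] is stable. *)
have := vf_stable_lin (- 4%:R) IHk (vf_stable_bracket DI (vf_stable_bracket DI IHk)).
congr vf_stable; rewrite exprS -/f -muE /vf_lin /vf_scale /D /vf_bracket /A /B /kappa /=.
rewrite -!mul_polyC polyCN rmorph_nat.
by congr (_, _, _); ring.
Qed.

Lemma stable_scale_bracket k :
  vf_stable (vf_bracket (vf_scale (('X ^+ 2 * mu1) ^+ k) A) B).
Proof. exact: vf_stable_bracket (stable_scaleA k) B_stable. Qed.

(** Descending induction on the order [i]: a stable field of order exactly [i] at the zero jet
    matches the leading coefficient, and the remainder has order at least [i.+1]. At order [N]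
    nothing is left to match. *)
Lemma stable_constant_term (g : {poly C}) d i : (i + d = N)%N ->
  exists v k, vf_stable v /\ 'X ^+ i * g = v.1.1 + 'X ^+ N * k.
Proof.
elim: d i g => [|d IHd] i g iN.
  exists (vf_scale 0 A), g; split; last by rewrite /= mul0r add0r -iN addn0.
  have := vf_stable_lin (-1) A_stable A_stable; congr vf_stable.
  by rewrite /vf_lin /vf_scale !scaleN1r !addNr !mul0r.
(* Even orders come from [(mu - 4)^k A]. Odd orders come from its bracket with [B], whose constant
   term carries the additional factor [eta], of order 1. *)
have [w [u [wI u0 wE]]] : exists w, exists u : {poly C},
    [/\ vf_stable w, u`_0 != 0 & w.1.1 = 'X ^+ i * u].
  have i2 := odd_double_half i; set k := i./2 in i2.
  case: (odd i) i2 => i2.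
    exists (vf_bracket (vf_scale (('X ^+ 2 * mu1) ^+ k) A) B), (- (mu1 ^+ k * beta * eta1)).
    split; first exact: stable_scale_bracket.
      rewrite -horner_coef0 hornerN oppr_eq0 !hornerM horner_exp !horner_coef0.
      by rewrite !mulf_neq0 // expf_neq0.
    rewrite /= etaE mulr0 subr0 exprMn -exprM mul2n -i2 exprD expr1.
    by ring.
  exists (vf_scale (('X ^+ 2 * mu1) ^+ k) A), (mu1 ^+ k * beta).
  split; first exact: stable_scaleA.
    by rewrite -horner_coef0 hornerM horner_exp !horner_coef0 mulf_neq0 // expf_neq0.
  by rewrite /= exprMn -exprM mul2n -i2 add0n mulrA.
set c := g`_0 / u`_0.
have [g' gE] : exists g', g - c *: u = 'X * g'.
  have : 'X %| g - c *: u.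
    rewrite -['X]subr0 -polyC0 dvdp_XsubCl /root horner_coef0 coefB coefZ.
    by rewrite /c divfK // subrr.
  by case/dvdpP => g' ->; exists g'; rewrite mulrC.
have [v [r [vI vE]]] := IHd i.+1 g' (etrans (addSnnS _ _) iN).
exists (vf_lin c w v), r; split; first exact: vf_stable_lin.
rewrite /= wE -addrA -vE exprSr -mulrA -gE -!mul_polyC.
by ring.
Qed.

Lemma stable_basis (i : 'I_N) :
  exists2 v, vf_stable v & forall k : 'I_N, v.1.1`_k = (k == i)%:R.
Proof.
have [v [r [vI vE]]] := stable_constant_term 1 (subnKC (ltnW (ltn_ord i))).
exists v => // k; have /(congr1 (fun p : {poly C} => p`_k)) := vE.
by rewrite mulr1 coefD coefXnM ltn_ord addr0 coefXn => <-.
Qed.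

Theorem stable_eq0 : (forall P, I P -> P@_0 = 0) -> forall P, I P -> P = 0.
Proof. by move=> I0; apply: stable_subspace_eq0 => // i; apply: stable_basis. Qed.

End TwoGenerators.
End StableSubspaces.

(** * Eventually rational functions of an integer *)

Section RationalGerms.
Import mpoly.
Local Open Scope ring_scope.
Variable C : numFieldType.

(* [phi] is eventually a rational function of [n] that is regular at [0], with
   value [v] and derivative [d] there. *)
Definition rat_germ (phi : nat -> C) (v d : C) : Prop :=
  exists p e : {poly C}, [/\ e.[0] != 0, p.[0] = v * e.[0],
    p^`().[0] = d * e.[0] + v * e^`().[0] &
    exists n0, forall n, (n0 <= n)%N -> phi n * e.[n%:R] = p.[n%:R]].

Lemma poly_eventually0 (p : {poly C}) n0 :
  (forall n, (n0 <= n)%N -> p.[n%:R] = 0) -> p = 0.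
Proof.
move=> p0; apply/eqP/negPn/negP => /max_poly_roots pN0.
pose rs : seq C := [seq (n0 + i)%:R | i <- iota 0 (size p)].
have rs_root : all (root p) rs.
  by apply/allP => _ /mapP[i _ ->]; rewrite /root p0 // leq_addr.
have rs_uniq : uniq rs.
  rewrite map_inj_uniq ?iota_uniq // => i j /eqP.
  by rewrite eqr_nat eqn_add2l => /eqP.
by have := pN0 rs rs_root rs_uniq; rewrite size_map size_iota ltnn.
Qed.

(** The numerator has infinitely many roots. Since [v] and [d] belong to the rational function and
    not to [phi 0], this turns vanishing at large [n] into information at [n = 0]. *)
Lemma rat_germ0 phi v d n0 : rat_germ phi v d ->
  (forall n, (n0 <= n)%N -> phi n = 0) -> v = 0 /\ d = 0.
Proof.
move=> [p [e [e0 pv pd [n1 pE]]]] phi0.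
have p0 : p = 0.
  apply: (@poly_eventually0 _ (maxn n0 n1)) => n; rewrite geq_max => /andP[n0n n1n].
  by rewrite -pE // phi0 // mul0r.
move: pv pd; rewrite p0 deriv0 horner0 => /esym/eqP.
rewrite mulf_eq0 (negPf e0) orbF => /eqP -> /esym/eqP.
by rewrite mul0r addr0 mulf_eq0 (negPf e0) orbF => /eqP ->.
Qed.

Lemma rat_germ_ext phi psi v d n0 : rat_germ phi v d ->
  (forall n, (n0 <= n)%N -> phi n = psi n) -> rat_germ psi v d.
Proof.
move=> [p [e [e0 pv pd [n1 pE]]]] phiE; exists p, e; split=> //.
exists (maxn n0 n1) => n; rewrite geq_max => /andP[n0n n1n].
by rewrite -phiE // pE.
Qed.

Lemma eq_rat_germ phi psi v d : rat_germ phi v d -> phi =1 psi -> rat_germ psi v d.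
Proof. by move=> g phiE; apply: (@rat_germ_ext _ _ _ _ 0%N g). Qed.

Lemma rat_germ_poly (p : {poly C}) : rat_germ (fun n => p.[n%:R]) p.[0] p^`().[0].
Proof.
exists p, 1; rewrite !hornerE oner_neq0 derivC horner0 mulr0 addr0; split=> //.
by exists 0%N => n _; rewrite hornerE mulr1.
Qed.

Lemma rat_germ_cst c : rat_germ (fun=> c) c 0.
Proof.
have := rat_germ_poly c%:P; rewrite derivC !hornerE => g.
by apply: eq_rat_germ g _ => n; rewrite hornerE.
Qed.

Lemma rat_germD phi psi v w d d' : rat_germ phi v d -> rat_germ psi w d' ->
  rat_germ (fun n => phi n + psi n) (v + w) (d + d').
Proof.
move=> [p [e [e0 pv pd [n0 pE]]]] [p' [e' [e0' pv' pd' [n0' pE']]]].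
exists (p * e' + p' * e), (e * e'); split.
- by rewrite hornerM mulf_neq0.
- by rewrite !(hornerD, hornerM) pv pv'; ring.
- by rewrite !(derivD, derivM) !(hornerD, hornerM) pv pv' pd pd'; ring.
exists (maxn n0 n0') => n; rewrite geq_max => /andP[n0n n0n'].
by rewrite !(hornerD, hornerM) -pE // -pE' //; ring.
Qed.

Lemma rat_germM phi psi v w d d' : rat_germ phi v d -> rat_germ psi w d' ->
  rat_germ (fun n => phi n * psi n) (v * w) (d * w + v * d').
Proof.
move=> [p [e [e0 pv pd [n0 pE]]]] [p' [e' [e0' pv' pd' [n0' pE']]]].
exists (p * p'), (e * e'); split.
- by rewrite hornerM mulf_neq0.
- by rewrite !(hornerD, hornerM) pv pv'; ring.
- by rewrite !(derivD, derivM) !(hornerD, hornerM) pv pv' pd pd'; ring.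
exists (maxn n0 n0') => n; rewrite geq_max => /andP[n0n n0n'].
by rewrite !(hornerD, hornerM) -pE // -pE' //; ring.
Qed.

Lemma rat_germZ c phi v d : rat_germ phi v d ->
  rat_germ (fun n => c * phi n) (c * v) (c * d).
Proof. by move=> g; have := rat_germM (rat_germ_cst c) g; rewrite mul0r add0r. Qed.

Lemma rat_germB phi psi v w d d' : rat_germ phi v d -> rat_germ psi w d' ->
  rat_germ (fun n => phi n - psi n) (v - w) (d - d').
Proof.
move=> g /(rat_germZ (-1)) g'; have := rat_germD g g'; rewrite !mulN1r.
by move/eq_rat_germ; apply => n; rewrite mulN1r.
Qed.

Lemma rat_germ_sum (I : Type) (r : seq I) (phi : I -> nat -> C) v d :
  (forall i, rat_germ (phi i) (v i) (d i)) ->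
  rat_germ (fun n => \sum_(i <- r) phi i n) (\sum_(i <- r) v i) (\sum_(i <- r) d i).
Proof.
move=> g; elim: r => [|i r IH].
  rewrite !big_nil; apply: eq_rat_germ (rat_germ_cst 0) _ => n.
  by rewrite big_nil.
rewrite !big_cons; apply: eq_rat_germ (rat_germD (g i) IH) _ => n.
by rewrite big_cons.
Qed.

Lemma rat_germ_div phi psi w d d' : rat_germ phi 1 d -> rat_germ psi w d' ->
  rat_germ (fun n => psi n / phi n) w (d' - w * d).
Proof.
move=> [p [e [e0 pv pd [n0 pE]]]] [p' [e' [e0' pv' pd' [n0' pE']]]].
rewrite mul1r in pv; rewrite mul1r in pd.
(* the extra factor [p] covers the [n] with [phi n = 0], where [psi n / phi n = 0] *)
exists (p' * e * p), (e' * p * p); split.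
- by rewrite !hornerM !mulf_neq0 // pv.
- by rewrite !(hornerD, hornerM) pv pv'; ring.
- by rewrite !(derivD, derivM) !(hornerD, hornerM) pv pv' pd pd'; ring.
exists (maxn n0 n0') => n; rewrite geq_max => /andP[n0n n0n'].
rewrite !(hornerD, hornerM) -pE // -pE' //; have [->|phiN0] := eqVneq (phi n) 0; first by ring.
by field.
Qed.

(** The chain rule, by closure of the claim under sums and products, starting from constants and
    variables. *)
Lemma rat_germ_meval N (phi : 'I_N -> nat -> C) (v d : 'I_N -> C) (P : {mpoly C[N]}) :
  (forall i, rat_germ (phi i) (v i) (d i)) ->
  rat_germ (fun n => P.@[fun i => phi i n]) P.@[v] (\sum_i P^`M(i).@[v] * d i).
Proof.
move=> g; pose G (P : {mpoly C[N]}) :=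
  rat_germ (fun n => P.@[fun i => phi i n]) P.@[v] (\sum_i P^`M(i).@[v] * d i).
have GC c : G c%:MP.
  rewrite /G mevalC big1 => [|i _]; last by rewrite mderivC meval0 mul0r.
  by apply: eq_rat_germ (rat_germ_cst c) _ => n; rewrite mevalC.
have GD P1 P2 : G P1 -> G P2 -> G (P1 + P2).
  move=> g1 g2; have := rat_germD g1 g2; rewrite -mevalD -big_split /= => g12.
  rewrite /G (eq_bigr (fun i => P1^`M(i).@[v] * d i + P2^`M(i).@[v] * d i)).
    by apply: eq_rat_germ g12 _ => n; rewrite mevalD.
  by move=> i _; rewrite mderivD mevalD mulrDl.
have GM P1 P2 : G P1 -> G P2 -> G (P1 * P2).
  move=> g1 g2; have := rat_germM g1 g2.
  rewrite -mevalM mulr_suml mulr_sumr -big_split /= => g12.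
  rewrite /G (eq_bigr (fun i => P1^`M(i).@[v] * d i * P2.@[v] +
      P1.@[v] * (P2^`M(i).@[v] * d i))).
    by apply: eq_rat_germ g12 _ => n; rewrite mevalM.
  by move=> i _; rewrite mderivM mevalD !mevalM; ring.
have GX i : G 'X_i.
  rewrite /G mevalXU (bigD1 i) //= big1 => [|j ji]; last first.
    by rewrite mderivX mnm1E eq_sym (negPf ji) scale0r meval0 mul0r.
  rewrite mderivX mnm1E eqxx scale1r (_ : _ - _ = 0)%MM; last first.
    by apply/mnmP => j; rewrite mnmBE subnn mnm0E.
  rewrite mpolyX0 meval1 mul1r addr0.
  by apply: eq_rat_germ (g i) _ => n; rewrite mevalXU.
rewrite -/(G P) [P]mpolyE; elim/big_ind: _ => [||m _]; first 2 last.
- rewrite -mul_mpolyC; apply: (GM) => //; rewrite mpolyXE_id.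
  elim/big_ind: _ => [||i _]; first 2 last.
  + by elim: (m i) => [|k IH]; rewrite ?expr0 ?exprS; [exact: (GC 1)|exact: (GM)].
  + exact: (GC 1).
  + exact: (GM).
- exact: (GC 0).
- exact: (GD).
Qed.

End RationalGerms.

(** * Powers of [q] and [q]-integers as polynomials in the exponent *)

Lemma sum_ord_support (V : zmodType) (F : nat -> V) a b :
  (forall i, (a <= i)%N -> F i = 0) -> (forall i, (b <= i)%N -> F i = 0) ->
  \sum_(i < a) F i = \sum_(i < b) F i.
Proof.
wlog ab : a b / (a <= b)%N => [W Fa Fb|Fa _].
  by case/orP: (leq_total a b) => ab; [|symmetry]; apply: W.
rewrite -!(big_mkord xpredT) [RHS](@big_cat_nat _ _ _ a) //= [X in _ + X]big1_seq ?addr0 //.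
by move=> i; rewrite mem_index_iota => /and3P[_ /Fa].
Qed.

Section BinomialPolynomials.
Variable C : numFieldType.

(** Binomial coefficients as polynomials in the upper argument; their derivatives at 0 are the
    coefficients of [log (1 + z)]. *)
Definition binom_poly k : {poly C} := (k`!%:R)^-1 *: \prod_(i < k) ('X - i%:R%:P).

Lemma fact_neq0 k : k`!%:R != 0 :> C.
Proof. by rewrite pnatr_eq0 -lt0n fact_gt0. Qed.

Lemma horner_binom_poly k n : (binom_poly k).[n%:R] = 'C(n, k)%:R.
Proof.
rewrite hornerZ; apply: (mulfI (fact_neq0 k)).
rewrite mulVKf ?fact_neq0 // -natrM mulnC bin_ffact.
elim: k => [|k IHk]; first by rewrite big_ord0 ffactn0 hornerE.
rewrite big_ord_recr hornerM /= IHk hornerXsubC ffactnSr natrM.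
have [nk|nk] := ltnP n k; first by rewrite ffact_small // !mul0r.
by rewrite natrB.
Qed.

Lemma binom_poly0_at0 : (binom_poly 0).[0] = 1.
Proof. by have := horner_binom_poly 0 0; rewrite bin0. Qed.

Lemma binom_polyS_at0 k : (binom_poly k.+1).[0] = 0.
Proof. by have := horner_binom_poly k.+1 0. Qed.

Lemma deriv_binom_poly0 : (binom_poly 0)^`().[0] = 0.
Proof. by rewrite /binom_poly big_ord0 derivZ derivC scaler0 horner0. Qed.

Lemma deriv_binom_polyS k : (binom_poly k.+1)^`().[0] = (-1) ^+ k / k.+1%:R.
Proof.
(* The factor ['X] vanishes at 0, so only the product of the other factors contributes, with values
   [-1, ..., -k]. *)
rewrite /binom_poly big_ord_recl subr0 derivZ derivM derivX hornerZ.
rewrite hornerD !hornerM hornerX mul0r addr0 (hornerC 1) mul1r horner_prod.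
rewrite (eq_bigr (fun i : 'I_k => (-1) * i.+1%:R)); last first.
  by move=> i _; rewrite hornerXsubC sub0r mulN1r.
rewrite big_split /= prodr_const card_ord -natr_prod factS natrM.
have -> : (\prod_(i < k) i.+1)%N = k`! by rewrite fact_prod big_add1 big_mkord.
by rewrite invfM mulrACA mulVf ?fact_neq0 // mulr1 mulrC.
Qed.

End BinomialPolynomials.

Section QPowers.
Variables (C : numFieldType) (M : nat) (b : {poly C}).
Let z := 'X * b.
Let q := z + 1.

Definition qint (q : {poly C}) n : {poly C} := \sum_(i < n) q ^+ i.

(* The truncated series of [log q / (q - 1)] in powers of [z = q - 1]. *)
Definition log_ratio : {poly C} := \sum_(k < M) ((-1) ^+ k / k.+1%:R) *: z ^+ k.

Definition poly_germ N (f : nat -> {poly C}) (v d : {poly C}) : Prop :=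
  forall j, (j < N)%N -> rat_germ (fun n => (f n)`_j) v`_j d`_j.

Let z_pow k j : (j < k)%N -> (z ^+ k)`_j = 0.
Proof. by move=> jk; rewrite exprMn coefXnM jk. Qed.

Let coef_qX n j : (j < M)%N -> (q ^+ n)`_j = \sum_(k < M) 'C(n, k)%:R * (z ^+ k)`_j.
Proof.
move=> jM; rewrite exprD1n coef_sum.
under eq_bigr do rewrite coefMn -mulr_natl.
apply: (@sum_ord_support _ (fun k => 'C(n, k)%:R * (z ^+ k)`_j)) => k km.
  by rewrite bin_small // mul0r.
by rewrite z_pow ?mulr0 // (leq_trans jM).
Qed.

Let coef_qint n j : (j < M)%N ->
  (qint q n)`_j = \sum_(k < M) 'C(n, k.+1)%:R * (z ^+ k)`_j.
Proof.
move=> jM; elim: n => [|n IHn].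
  by rewrite /qint big_ord0 coef0 big1 // => k _; rewrite bin0n mul0r.
rewrite /qint big_ord_recr coefD -/(qint q n) IHn coef_qX // -big_split /=.
by apply: eq_bigr => k _; rewrite binS natrD mulrDl.
Qed.

(** Expand [(1 + z)^n] by the binomial theorem: [z] is divisible by ['X], so finitely many terms
    count modulo ['X ^+ M], each polynomial in [n]. The derivative at [n = 0] is [log q]. *)
Lemma poly_germ_qX : poly_germ M (fun n => q ^+ n) 1 (z * log_ratio).
Proof.
(* The extra term [k = M] has coefficient 0, but it aligns the derivative with the [M] terms of
   [z * log_ratio]. *)
move=> j jM; pose p := \sum_(k < M.+1) (z ^+ k)`_j *: binom_poly C k.
have -> : (1 : {poly C})`_j = p.[0].
  rewrite horner_sum big_ord_recl big1 => [|k _].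
    by rewrite hornerZ binom_poly0_at0 expr0 mulr1 addr0.
  by rewrite hornerZ binom_polyS_at0 mulr0.
have -> : (z * log_ratio)`_j = p^`().[0].
  rewrite raddf_sum /= horner_sum big_ord_recl derivZ hornerZ deriv_binom_poly0 mulr0 add0r.
  rewrite mulr_sumr coef_sum; apply: eq_bigr => k _.
  by rewrite derivZ hornerZ deriv_binom_polyS -scalerAr -exprS coefZ mulrC.
apply: eq_rat_germ (rat_germ_poly p) _ => n.
rewrite coef_qX // horner_sum big_ord_recr /= z_pow // scale0r horner0 addr0.
by apply: eq_bigr => k _; rewrite hornerZ horner_binom_poly mulrC.
Qed.

Lemma poly_germ_qint : poly_germ M (qint q) 0 log_ratio.
Proof.
move=> j jM; pose p := \sum_(k < M) (z ^+ k)`_j *: binom_poly C k.+1.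
have -> : (0 : {poly C})`_j = p.[0].
  rewrite horner_sum big1 ?coef0 // => k _.
  by rewrite hornerZ binom_polyS_at0 mulr0.
have -> : log_ratio`_j = p^`().[0].
  rewrite raddf_sum /= horner_sum coef_sum; apply: eq_bigr => k _.
  by rewrite derivZ hornerZ deriv_binom_polyS coefZ mulrC.
apply: eq_rat_germ (rat_germ_poly p) _ => n.
rewrite coef_qint // horner_sum.
by apply: eq_bigr => k _; rewrite hornerZ horner_binom_poly mulrC.
Qed.

Lemma poly_germD N f g v w d d' : poly_germ N f v d -> poly_germ N g w d' ->
  poly_germ N (fun n => f n + g n) (v + w) (d + d').
Proof.
move=> fg gg j jN; rewrite !coefD.
by apply: eq_rat_germ (rat_germD (fg j jN) (gg j jN)) _ => n; rewrite coefD.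
Qed.

Lemma poly_germMr N f v d (y : {poly C}) : poly_germ N f v d ->
  poly_germ N (fun n => f n * y) (v * y) (d * y).
Proof.
move=> fg j jN; rewrite !coefM.
have H : rat_germ (fun n => \sum_(i < j.+1) (f n)`_i * y`_(j - i))
    (\sum_(i < j.+1) v`_i * y`_(j - i)) (\sum_(i < j.+1) d`_i * y`_(j - i)).
  apply: (@rat_germ_sum _ _ _ (fun (i : 'I_j.+1) n => (f n)`_i * y`_(j - i))) => i.
  have iN : (i < N)%N by apply: leq_ltn_trans jN; rewrite -ltnS.
  by have := rat_germM (fg i iN) (rat_germ_cst y`_(j - i)); rewrite mulr0 addr0.
by apply: eq_rat_germ H _ => n; rewrite coefM.
Qed.

Lemma poly_germ_ext N f g v d n0 : poly_germ N f v d ->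
  (forall n, (n0 <= n)%N -> eq_modX N (f n) (g n)) -> poly_germ N g v d.
Proof.
move=> fg fE j jN; apply: (@rat_germ_ext _ _ _ _ _ n0 (fg j jN)) => n n0n.
exact: (iffLR (eq_modXP _ _ _) (fE n n0n)).
Qed.

Lemma poly_germ_div N f u (y d : {poly C}) n0 : poly_germ N f 1 d ->
  (forall n, (n0 <= n)%N -> (f n)`_0 != 0 /\ eq_modX N (f n * u n) y) ->
  poly_germ N u y (- (d * y)).
Proof.
move=> fg fu j; have [n] := ubnP j; elim: n j => // n IHn j jn jN.
have N0 : (0 < N)%N by apply: leq_ltn_trans jN.
(* All terms of the [j]-th coefficient of [f u] except the one with the unknown [u_j]. *)
pose s n := \sum_(i < j) (f n)`_(i.+1) * (u n)`_(j - i.+1).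
have sg : rat_germ s 0 (\sum_(i < j) d`_(i.+1) * y`_(j - i.+1)).
  have v0 : \sum_(i < j) (1 : {poly C})`_(i.+1) * y`_(j - i.+1) = 0.
    by rewrite big1 // => i _; rewrite coef1 mul0r.
  rewrite -[X in rat_germ _ X _]v0 /s.
  apply: (@rat_germ_sum _ _ _ (fun (i : 'I_j) n => (f n)`_(i.+1) * (u n)`_(j - i.+1))) => i.
  have iN : (i.+1 < N)%N by apply: leq_ltn_trans jN.
  have ij : (j - i.+1 < j)%N by have := ltn_ord i; lia.
  have jn' : (j - i.+1 < n)%N by apply: leq_trans ij _; rewrite -ltnS.
  have := rat_germM (fg _ iN) (IHn _ jn' (ltn_trans ij jN)).
  by rewrite coef1 !mul0r addr0.
have fg0 : rat_germ (fun n => (f n)`_0) 1 d`_0 by have := fg 0%N N0; rewrite coef1.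
have dg := rat_germ_div fg0 (rat_germB (rat_germ_cst y`_j) sg).
have -> : (- (d * y))`_j =
    0 - \sum_(i < j) d`_i.+1 * y`_(j - i.+1) - (y`_j - 0) * d`_0.
  rewrite coefN coefM big_ord_recl subn0.
  rewrite -[X in - (_ + X)]/(\sum_(i < j) d`_i.+1 * y`_(j - i.+1)).
  by ring.
rewrite -[X in rat_germ _ X _]subr0; apply: (@rat_germ_ext _ _ _ _ _ n0 dg) => m m0.
have [f0 /eq_modXP/(_ j jN)] := fu m m0.
rewrite coefM big_ord_recl subn0 -[X in _ + X]/(s m) => <-.
by rewrite addrK mulrC mulKf.
Qed.

End QPowers.

(** * Expansion of [log q / (q - 1)] to second order *)

Lemma root0_factor (C : fieldType) (p : {poly C}) : p.[0] = 0 -> exists r, p = 'X * r.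
Proof.
move=> p0; have /dvdpP[r ->] : 'X %| p.
  by rewrite -['X]subr0 -polyC0 dvdp_XsubCl /root p0.
by exists r; rewrite mulrC.
Qed.

Lemma double_root0_factor (C : fieldType) (p : {poly C}) :
  p.[0] = 0 -> p^`().[0] = 0 ->
  exists r, p = 'X ^+ 2 * r /\ p^`()^`().[0] = 2%:R * r.[0].
Proof.
move=> /root0_factor[r ->]; rewrite derivM derivX mul1r !(hornerD, hornerM) hornerX.
rewrite mul0r addr0 => /root0_factor[s ->]; exists s; split; first by ring.
rewrite !(derivD, derivM, derivX) !(hornerD, hornerM) !hornerX.
by rewrite !(hornerC 1); ring.
Qed.

Section LogRatioExpansion.
Variables (C : numFieldType) (M : nat) (b : {poly C}).
Hypotheses (M3 : (3 <= M)%N) (b0 : b.[0] = 1) (b1 : b^`().[0] = 2^-1).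
Let z := 'X * b.
Let q := z + 1.
Let beta := log_ratio M b.
Let kappa := q * beta ^+ 2.

Lemma log_ratio_expand : exists w,
  beta = 1 - (2^-1)%:P * z + (3^-1)%:P * z ^+ 2 + z ^+ 3 * w.
Proof.
have [m ME] : exists m, M = (3 + m)%N by exists (M - 3)%N; rewrite subnKC.
exists (\sum_(k < m) ((-1) ^+ (k + 3) / (k + 3).+1%:R) *: z ^+ k).
rewrite /beta /log_ratio ME -/z.
rewrite !big_ord_recl -[X in _ + (_ + (_ + X))]/(
  \sum_(k < m) ((-1) ^+ (3 + k) / (3 + k).+1%:R) *: z ^+ (3 + k)).
rewrite !addrA; congr (_ + _ + _ + _); last first.
  by rewrite mulr_sumr; apply: eq_bigr => k _; rewrite -scalerAr -exprD [(3 + k)%N]addnC.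
all: rewrite -mul_polyC /=.
- by rewrite sqrrN expr1n mul1r.
- by rewrite !expr1 mulN1r polyCN mulNr.
- by rewrite !expr0 divr1 mulr1.
Qed.

(** With [z = h + h^2/2 + O(h^3)], this is the expansion [h / (e^h - 1) = 1 - h/2 + h^2/12 +
    O(h^3)]. *)
Lemma log_ratio_at0 :
  [/\ beta.[0] = 1, beta^`().[0] = - 2^-1 & beta^`()^`().[0] = 6^-1].
Proof.
have [w ->] := log_ratio_expand; rewrite /z !expr2 !exprS expr0.
do 3 rewrite ?(derivD, derivN, derivM, derivX, derivC, derivB)
  ?(hornerD, hornerN, hornerM, hornerX, hornerC).
rewrite !b0 !b1; split; by field.
Qed.

Lemma kappa_at0 :
  [/\ kappa.[0] = 1, kappa^`().[0] = 0 & kappa^`()^`().[0] = - 6^-1].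
Proof.
have [B0 B1 B2] := log_ratio_at0; rewrite /kappa /q /z !expr2.
do 3 rewrite ?(derivD, derivN, derivM, derivX, derivC, derivB)
  ?(hornerD, hornerN, hornerM, hornerX, hornerC).
rewrite !B0 !B1 !B2 !b0 !b1; split; by field.
Qed.

(* [kappa = 1 - X^2/12 + O(X^3)] and [z * beta = X + O(X^2)], so that the square
   of [ad [A, B]] is [4 + 10/3 X^2 + O(X^3)]. *)
Lemma ad_square_expand : exists mu1 : {poly C}, mu1`_0 != 0 /\
  4%:R * kappa * (kappa + (z * beta) ^+ 2) - 4%:R = 'X ^+ 2 * mu1.
Proof.
have [K0 K1 K2] := kappa_at0; have [B0 B1 B2] := log_ratio_at0.
have -> : 4%:R = (4%:R)%:P :> {poly C} by rewrite rmorph_nat.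
clearbody kappa beta; set mu := _ - _.
have [||mu1 [muE mu2]] := @double_root0_factor _ mu.
- rewrite /mu !expr2 !(hornerD, hornerN, hornerM, hornerX, hornerC) K0.
  by ring.
- rewrite /mu !expr2 ?(derivD, derivN, derivM, derivX, derivC).
  by rewrite !(hornerD, hornerN, hornerM, hornerX, hornerC) !K0 !K1; ring.
exists mu1; split=> //; rewrite -horner_coef0.
suff mu1E : mu1.[0] = 10%:R / 3%:R by rewrite mu1E mulf_neq0 ?invr_neq0 ?pnatr_eq0.
apply: (mulfI (_ : 2%:R != 0)); first by rewrite pnatr_eq0.
rewrite -mu2 /mu !expr2.
do 3 rewrite ?(derivD, derivN, derivM, derivX, derivC, derivB)
  ?(hornerD, hornerN, hornerM, hornerX, hornerC).
by rewrite !K0 !K1 !K2 !B0 !B1 !b0 !b1; field.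
Qed.

End LogRatioExpansion.

(** * Independence of jets with the symmetries of q-rationals *)

Section JetIndependence.
Import mpoly.
Local Open Scope ring_scope.
Variables (C : numFieldType) (N M : nat) (b : {poly C}) (a : rat -> {poly C}).
Let q := 'X * b + 1.
Let beta := log_ratio M b.
Let eta := 'X * b * beta.
Hypotheses (b0 : b.[0] = 1) (b1 : b^`().[0] = 2^-1).
Hypotheses (M3 : (3 <= M)%N) (NM : (N <= M)%N).
Hypothesis jet0 : eq_modX M (a 0) 0.
Hypothesis jetD1 : forall x, eq_modX M (a (x + 1)) (q * a x + 1).
Hypothesis jet_neginv : forall x, x != 0 -> eq_modX M (q * a x * a (- x^-1)) (-1).
Hypothesis jet_cst : forall x, (a x)`_0 = ratr x.

Lemma mcoeff_0_meval (P : {mpoly C[N]}) : P@_0 = P.@[fun=> 0].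
Proof.
elim/mpolyind: P => [|c m P _ _ IHP]; first by rewrite mcoeff0 meval0.
rewrite mcoeffD mevalD IHP mcoeffZ mevalZ mcoeffX mevalX; congr (_ * _ + _).
have [->|mN0] := eqVneq m 0%MM; first by rewrite big1 // => i _; rewrite mnm0E expr0.
have [i mi] : exists i, m i != 0%N.
  apply/existsP; rewrite -negb_forall; apply: contra mN0 => /forallP m0.
  by apply/eqP/mnmP => i; rewrite mnm0E; apply/eqP.
by rewrite (bigD1 i) //= expr0n (negPf mi) mul0r.
Qed.

Definition jet_values (y : {poly C}) (i : 'I_N) : C := i`!%:R * y`_i.

Lemma meval_vf_der (v : vfield C) (P : {mpoly C[N]}) y :
  (vf_der v P).@[jet_values y] = \sum_i P^`M(i).@[jet_values y] *
    (i`!%:R * (v.1.1 + v.1.2 * y + v.2 * y ^+ 2)`_i).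
Proof.
pose ev := map_poly (@meval N C (jet_values y)).
rewrite raddf_sum; apply: eq_bigr => i _ /=.
rewrite mevalM mevalZ mulrC; congr (_ * (_ * _)).
rewrite -[LHS](coef_map _ (vf_eval N v)) /= -/ev.
have evC p : ev (map_poly (@mpolyC N C) p) = p.
  by apply/polyP => k; rewrite !coef_map /= mevalC.
have evY k : (k < N)%N -> (ev (generic_jet C N))`_k = y`_k.
  move=> kN; rewrite coef_map /= (coef_generic_jet C (Ordinal kN)) mevalZ mevalXU.
  by rewrite /jet_values mulKf // fact_neq0.
rewrite /vf_eval /ev !(rmorphD, rmorphM, rmorphXn) /= -/ev !evC !coefD.
have E k (p : {poly C}) : (k < N)%N -> (p * ev (generic_jet C N))`_k = (p * y)`_k.
  by move=> kN; rewrite ![p * _]mulrC; apply: eq_coefMl kN.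
congr (_ + _ + _); first exact: E.
by rewrite mulrA E // mulrAC E // expr2; congr (nth _ (polyseq _) _); ring.
Qed.

(** If the curve [u] passes through [y] at [n = 0] with velocity [v], then a polynomial vanishing on
    it for large [n] vanishes at [y] together with its derivative along [v]. *)
Lemma vanish_along_germ (v : vfield C) (P : {mpoly C[N]}) u y n0 :
  poly_germ M u y (v.1.1 + v.1.2 * y + v.2 * y ^+ 2) ->
  (forall n, (n0 <= n)%N -> P.@[jet_values (u n)] = 0) ->
  P.@[jet_values y] = 0 /\ (vf_der v P).@[jet_values y] = 0.
Proof.
move=> ug Pu; rewrite meval_vf_der.
apply: (rat_germ0 (n0 := n0) _ Pu).
apply: (rat_germ_meval (phi := fun i n => jet_values (u n) i)) => i.
exact: rat_germZ (ug i (leq_trans (ltn_ord i) NM)).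
Qed.

Lemma jetDn x n : eq_modX M (a (x + n%:R)) (q ^+ n * a x + qint q n).
Proof.
elim: n => [|n [k IHn]].
  by exists 0; rewrite /qint big_ord0 expr0 !mulr0 !addr0 mul1r.
have [l E] := jetD1 (x + n%:R); exists (l + q * k).
have qintS : qint q n.+1 = 1 + q * qint q n.
  rewrite /qint big_ord_recl expr0 mulr_sumr; congr (_ + _).
  by apply: eq_bigr => i _; rewrite lift0 exprS.
by rewrite -natr1 addrA E IHn qintS exprS; ring.
Qed.

Let vA : vfield C := (beta, eta, 0).
Let vB : vfield C := (0, - eta, q * beta).

(** Differentiate [q^n y + [n]_q] in [n] at 0: the result is [eta y + beta]. *)
Lemma jet_flowA x : poly_germ M (fun n => a (x + n%:R)) (a x)
  (vA.1.1 + vA.1.2 * a x + vA.2 * a x ^+ 2).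
Proof.
have g := poly_germD (poly_germMr (a x) (@poly_germ_qX C M b)) (@poly_germ_qint C M b).
rewrite mul1r addr0 in g.
rewrite /vA /= mul0r addr0 addrC; apply: (@poly_germ_ext _ _ _ _ _ _ 0%N g) => n _.
have [k ->] := jetDn x n; exists (- k); ring.
Qed.

(** This flow is the translation by [n] conjugated by [x -> -1/x]. On jets it gives [y / (q^n - q
    [n]_q y)], whence the use of [poly_germ_div]. *)
Lemma jet_flowB x : poly_germ M (fun n => a (x / (1 - n%:R * x))) (a x)
  (vB.1.1 + vB.1.2 * a x + vB.2 * a x ^+ 2).
Proof.
have g := poly_germD (@poly_germ_qX C M b) (poly_germMr (- q * a x) (@poly_germ_qint C M b)).
rewrite mul0r addr0 in g.
have -> : vB.1.1 + vB.1.2 * a x + vB.2 * a x ^+ 2 =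
    - (('X * b * log_ratio M b + log_ratio M b * (- q * a x)) * a x).
  by rewrite /vB /eta -/beta /=; ring.
(* Beyond [n0] the denominator [1 - n x] is nonzero; it is also the constant coefficient of [q^n - q
   [n]_q y]. *)
have [n0 n0P] : exists n0, forall n, (n0 <= n)%N -> n%:R * x != 1.
  exists (Num.bound `|x^-1|) => n n0n; apply/eqP => nx.
  have xN0 : x != 0 by apply/eqP => x0; move/eqP: nx; rewrite x0 mulr0 eq_sym oner_eq0.
  have xV : x^-1 = n%:R by apply: (mulIf xN0); rewrite nx mulVf.
  have := archi_boundP (normr_ge0 x^-1); move: n0n.
  by rewrite xV normr_nat ltr_nat ltnNge => ->.
apply: (@poly_germ_div _ _ _ _ _ _ n0 g) => n /n0P nx; split.
  rewrite -horner_coef0 hornerD !hornerM hornerN horner_exp horner_sum -/q.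
  have q0 : q.[0] = 1 by rewrite !hornerE.
  rewrite q0 expr1n (eq_bigr (fun=> 1)); last by move=> i _; rewrite horner_exp q0 expr1n.
  rewrite sumr_const card_ord mulN1r horner_coef0 jet_cst mulrN -ratr_nat -rmorphM.
  by rewrite subr_eq0 -(rmorph1 (@ratr C)) (inj_eq (fmorph_inj _)) eq_sym.
have [->|xN0] := eqVneq x 0.
  rewrite mul0r; have [k kE] := jet0; set f := _ + _.
  by exists (f * k - k); rewrite kE; ring.
have x1N0 : 1 - n%:R * x != 0 by rewrite subr_eq0 eq_sym.
set w := - x^-1 + n%:R; have wE : w = - (1 - n%:R * x) / x by rewrite /w; field.
have wN0 : w != 0 by rewrite wE mulf_neq0 ?oppr_eq0 ?invr_neq0.
have -> : x / (1 - n%:R * x) = - w^-1 by rewrite wE; field; rewrite x1N0 xN0.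
have [k1 E1] := jet_neginv xN0; have [k2 E2] := jet_neginv wN0.
have [k3 E3] := jetDn (- x^-1) n.
rewrite -/w in E3.
set u := a (- w^-1) in E2 *; set a' := a (- x^-1) in E1 E3.
exists ((k1 * q ^+ n + k3 * q * a x) * u - k2 * a x).
(* Replacing 1 by [- q a(x) a(-1/x)] modulo ['X ^+ M] lets [q^n a(-1/x) + [n]_q], the jet of [w],
   appear as a factor. *)
have one : 1 = 'X ^+ M * k1 - q * a x * a' by rewrite E1; ring.
have -> : (q ^+ n + qint q n * (- q * a x)) * u =
    (q ^+ n * ('X ^+ M * k1 - q * a x * a') + qint q n * (- q * a x)) * u.
  by rewrite -one mulr1.
have -> : (q ^+ n * ('X ^+ M * k1 - q * a x * a') + qint q n * (- q * a x)) * u =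
    - (q * a w * u) * a x + 'X ^+ M * ((k1 * q ^+ n + k3 * q * a x) * u).
  by rewrite E3; ring.
by rewrite E2; ring.
Qed.

Theorem jets_alg_independent (P : {mpoly C[N]}) :
  (forall x, x != 0 -> x != 1 -> P.@[jet_values (a x)] = 0) -> P = 0.
Proof.
move=> P0; pose I (Q : {mpoly C[N]}) := forall x, Q.@[jet_values (a x)] = 0.
have I_lin c Q R : I Q -> I R -> I (c *: Q + R).
  by move=> IQ IR x; rewrite mevalD mevalZ IQ IR mulr0 addr0.
have [mu1 [mu10 muE]] := ad_square_expand M3 b0 b1.
have IA : vf_stable I vA.
  move=> Q IQ x; have := vanish_along_germ (n0 := 0%N) (jet_flowA x).
  by move=> /(_ Q) [] // n _; apply: IQ.
have IB : vf_stable I vB.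
  move=> Q IQ x; have := vanish_along_germ (n0 := 0%N) (jet_flowB x).
  by move=> /(_ Q) [] // n _; apply: IQ.
(* The excluded points 0 and 1 are recovered by analytic continuation: for large [n] the point
   [x + n] exceeds 1, and the germ along [A] returns to [x]. *)
have IP : I P.
  move=> x.
  have [] // := vanish_along_germ (n0 := (Num.bound `|x|).+2) (jet_flowA x) (P := P).
  move=> n nx; have : 1 < x + n%:R.
    have := archi_boundP (normr_ge0 x); have := ler_norm (- x).
    by move: nx; rewrite normrN -(ler_nat rat) -addn2 natrD => ? ? ?; lra.
  by move=> x1; apply: P0; apply/eqP => E; rewrite E in x1.
have [beta0 _ _] := log_ratio_at0 M3 b0 b1.
apply: (@stable_eq0 C N I I_lin q beta eta (b * beta) mu1) => //.
- by rewrite -horner_coef0 beta0 oner_neq0.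
- by rewrite /eta mulrA.
- by rewrite -horner_coef0 hornerM b0 beta0 mul1r oner_neq0.
- move=> Q IQ; rewrite mcoeff_0_meval.
  apply: etrans (IQ 0); apply: meval_eq => i.
  have /eq_modXP a0 := jet0.
  by rewrite /jet_values a0 ?coef0 ?mulr0 // (leq_trans (ltn_ord i)).
Qed.

End JetIndependence.

(** * Derivatives of rational functions of the exponential *)

Section TruncatedExp.
Variables (K : numFieldType) (M0 : nat).

Definition exp_poly : {poly K} := \poly_(k < M0) (k`!%:R)^-1.

(** The operator [q d/dq], which is [d/dh] for [q = e^h]. *)
Definition euler_op (p : {poly K}) : {poly K} := 'X * p^`().

Lemma horner_exp_poly0 : (0 < M0)%N -> exp_poly.[0] = 1.
Proof. by move=> M0_gt0; rewrite horner_coef0 coef_poly M0_gt0 fact0 invr1. Qed.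

Lemma deriv_exp_poly : eq_modX M0.-1 exp_poly^`() exp_poly.
Proof.
apply/eq_modXP => k kM; have kM0 : (k.+1 < M0)%N by lia.
rewrite coef_deriv !coef_poly kM0 (ltnW kM0) factS natrM invfM -[LHS]mulr_natl.
by rewrite mulVKf // pnatr_eq0.
Qed.

Lemma comp_exp_poly0 p : (0 < M0)%N -> (p \Po exp_poly).[0] = p.[1].
Proof. by move=> M0_gt0; rewrite horner_comp horner_exp_poly0. Qed.

Lemma deriv_comp_exp p : eq_modX M0.-1 (p \Po exp_poly)^`() (euler_op p \Po exp_poly).
Proof.
have [k kE] := deriv_exp_poly.
exists ((p^`() \Po exp_poly) * k).
by rewrite deriv_comp kE comp_polyM comp_polyX; ring.
Qed.

(* Differentiating [s * d(E) = n(E)] gives the quotient rule for [s]. *)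
Lemma deriv_quotient_exp M n d s : (M < M0)%N ->
  eq_modX M.+1 (s * (d \Po exp_poly)) (n \Po exp_poly) ->
  eq_modX M (s^`() * ((d ^+ 2) \Po exp_poly))
    ((euler_op n * d - n * euler_op d) \Po exp_poly).
Proof.
move=> MM0 [k kE]; have MM0' : (M <= M0.-1)%N by lia.
have [kn nE] := deriv_comp_exp n; have [kd dE] := deriv_comp_exp d.
have := congr1 deriv kE; rewrite derivM derivD derivM derivXn nE dE.
rewrite -(subnK MM0') exprD /= => E.
pose m := (M0.-1 - M)%N; rewrite -/m in E.
set e := exp_poly in E kE *.
set u := s^`() * (d \Po e) in E *.
rewrite comp_polyB !comp_polyM.
set r := 'X^m * kn + M.+1%:R * k + 'X * k^`() - 'X^m * s * kd.
exists (r * (d \Po e) - 'X * k * (euler_op d \Po e)).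
have -> : s^`() * ((d \Po e) * (d \Po e)) = u * (d \Po e) by rewrite /u; ring.
have -> : u = (euler_op n \Po e) + 'X^M * r - s * (euler_op d \Po e).
  rewrite /r; move: E; rewrite -[_ *+ M.+1]mulr_natl exprS => E.
  by apply: (addIr (s * ((euler_op d \Po e) + 'X^m * 'X^M * kd))); rewrite E; ring.
rewrite mulrBl.
have -> : s * (euler_op d \Po e) * (d \Po e) =
    (s * (d \Po e)) * (euler_op d \Po e) by ring.
by rewrite kE exprS /euler_op !comp_polyM; ring.
Qed.

End TruncatedExp.

(* Imported only here: the notations of the analysis library clash with those of
   mpoly, which the sections above import. *)
From mathcomp Require Import all_classical all_reals all_analysis.
Import numFieldNormedType.Exports.
Local Open Scope complex_scope.

Section QuotientDerivatives.
Variable R : realType.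

Lemma near_eq_derive1n (f g : R -> R) k a :
  (\forall x \near a, f x = g x) -> derive1n k f a = derive1n k g a.
Proof.
elim: k f g => [|k IHk] f g fg; first exact: nbhs_singleton fg.
rewrite !derive1Sn; apply: IHk; apply: filterS (near_join fg) => x fgx.
by rewrite !derive1E; apply: near_eq_derive.
Qed.

Lemma is_derive_horner_expR (p : {poly R}) (x : R) :
  is_derive x 1 (fun h => p.[expR h]) (euler_op p).[expR x].
Proof.
rewrite /euler_op hornerM hornerX mulrC.
exact: (@is_derive1_comp _ (horner p) (@expR R)).
Qed.

Lemma derive1_quotient_expR (n d : {poly R}) (x : R) : d.[expR x] != 0 ->
  derive1 (fun h => n.[expR h] / d.[expR h]) x =
  (euler_op n * d - n * euler_op d).[expR x] / (d ^+ 2).[expR x].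
Proof.
move=> dx; rewrite derive1E.
have dV := is_deriveV (f := fun h => d.[expR h]) dx (is_derive_horner_expR d x).
have H := is_deriveM (is_derive_horner_expR n x) dV.
have -> : (fun h => n.[expR h] / d.[expR h]) =
  (fun h => n.[expR h]) * (fun h => (d.[expR h])^-1) by [].
rewrite derive_val !(hornerD, hornerN, hornerM) /GRing.scale /=.
by field.
Qed.

Lemma near_horner_expR_neq0 (d : {poly R}) (x : R) : d.[expR x] != 0 ->
  \forall y \near x, d.[expR y] != 0.
Proof.
move=> dx; have [ed _] := is_derive_horner_expR d x.
have : {for x, continuous (fun h => d.[expR h])}.
  exact/differentiable_continuous/derivable1_diffP.
by move/cvgr_neq0; apply.
Qed.

(** Induction on [k]: the analytic derivative and the formal one both replace [n / d] by the same
    fraction with denominator [d ^+ 2], nonzero at [q = 1]. *)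
Lemma derive1n_quotient_expR M0 (n d s : {poly R}) k : (k < M0)%N -> d.[1] != 0 ->
  eq_modX k.+1 (s * (d \Po exp_poly R M0)) (n \Po exp_poly R M0) ->
  derive1n k (fun h => n.[expR h] / d.[expR h]) 0 = k`!%:R * s`_k.
Proof.
elim: k n d s => [|k IHk] n d s kM d1 sE.
  rewrite /= expR0 fact0 mul1r; have [l /(congr1 (horner^~ 0))] := sE.
  rewrite hornerD !hornerM !comp_exp_poly0 // expr1 hornerX mul0r addr0.
  by rewrite horner_coef0 => <-; rewrite mulfK.
have d1' : d.[expR 0] != 0 by rewrite expR0.
rewrite derive1Sn (near_eq_derive1n (g := fun h =>
    (euler_op n * d - n * euler_op d).[expR h] / (d ^+ 2).[expR h])); last first.
  apply: filterS (near_horner_expR_neq0 d1') => x; exact: derive1_quotient_expR.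
rewrite (IHk _ _ s^`()) ?(ltnW kM) ?horner_exp ?expf_neq0 //; last first.
  exact: deriv_quotient_exp kM sE.
by rewrite coef_deriv factS natrM -mulr_natr; ring.
Qed.

End QuotientDerivatives.

(** * Jets of q-rationals *)

Local Notation tofrac := FracField.tofrac.

(** The fraction may be non-reduced; the two conditions at [q = 1] record that it is regular there,
    with value [x]. *)
Definition q_fraction (x : rat) (n d : {poly rat}) : Prop :=
  [/\ q_rational (Some x) = Some (tofrac n / tofrac d), d.[1] != 0 & n.[1] = x * d.[1]].

Lemma q_fraction0 : q_fraction 0 0 1.
Proof.
split; rewrite ?hornerC ?mul0r ?oner_neq0 //.
exact: q_rational0 q_rationalP.
Qed.

Lemma tofrac_horner1_neq0 (d : {poly rat}) : d.[1] != 0 -> tofrac d != 0.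
Proof. by rewrite tofrac_eq0; apply: contraNneq => ->; rewrite horner0. Qed.

Lemma q_fractionD1 x n d : q_fraction x n d -> q_fraction (x + 1) ('X * n + d) d.
Proof.
move=> [xE d1 n1]; split=> //; last by rewrite hornerD hornerM hornerX n1; ring.
have := q_rationalD1 q_rationalP (Some x).
rewrite /P1_affine /omap /obind /oapp mul1r xE => ->.
by congr Some; rewrite tofracD tofracM -/Qq_q mulrDl divff ?tofrac_horner1_neq0 // mulrA.
Qed.

Lemma q_fractionB1 x n d : q_fraction x n d -> q_fraction (x - 1) (n - d) ('X * d).
Proof.
move=> [xE d1 n1]; split.
- apply: (can_inj (QRational.TK Qq_q_neq0)).
  have := q_rationalD1 q_rationalP (Some (x - 1)).
  rewrite /QRational.T /P1_affine /omap /obind /oapp mul1r subrK xE => <-; congr Some.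
  rewrite tofracB tofracM -/Qq_q invfM mulrCA mulVKf ?Qq_q_neq0 //.
  by rewrite mulrBl divff ?tofrac_horner1_neq0 // subrK.
- by rewrite hornerM hornerX mul1r.
- by rewrite hornerD hornerN hornerM hornerX n1; ring.
Qed.

Lemma q_fraction_neginv x n d : x != 0 -> q_fraction x n d ->
  q_fraction (- x^-1) (- d) ('X * n).
Proof.
move=> x0 [xE d1 n1].
have n10 : n.[1] != 0 by rewrite n1 mulf_neq0.
split.
- have := q_rational_neginv q_rationalP (Some x).
  rewrite xE /P1_neginv /P1_affine /omap /obind /oapp (negPf x0) => ->.
  have nN0 := tofrac_horner1_neq0 n10; have dN0 := tofrac_horner1_neq0 d1.
  rewrite addr0 mulf_eq0 (negPf Qq_q_neq0) mulf_eq0 invr_eq0 (negPf nN0) (negPf dN0).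
  congr Some; rewrite tofracN tofracM -/Qq_q mulNr; congr (- _).
  by rewrite mulrA invf_div.
- by rewrite hornerM hornerX mul1r.
- by rewrite hornerN hornerM hornerX n1; field.
Qed.

Lemma q_fraction_exists x : exists n d, q_fraction x n d.
Proof.
pose K x := exists n d, q_fraction x n d.
have K0 : K 0 by exists 0, 1; apply: q_fraction0.
have KD y : K y -> K (y + 1) by move=> [n [d H]]; eexists; eexists; apply: q_fractionD1 H.
have KB y : K y -> K (y - 1) by move=> [n [d H]]; eexists; eexists; apply: q_fractionB1 H.
have KS y : y != 0 -> K y -> K (- y^-1).
  by move=> y0 [n [d H]]; eexists; eexists; apply: q_fraction_neginv H.
have Kpos m a b : (0 < a)%N -> (0 < b)%N -> (a + b <= m)%N -> K (a%:R / b%:R).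
  elim: m a b => [|m IH] a b a0 b0 abm; first by lia.
  have a0' : a%:R != 0 :> rat by rewrite pnatr_eq0; lia.
  have b0' : b%:R != 0 :> rat by rewrite pnatr_eq0; lia.
  case: (ltngtP a b) => [ab|ab|->]; last by rewrite divff // -[1]add0r; apply: KD.
  - have ba0 : b%:R - a%:R != 0 :> rat by rewrite subr_eq0 eqr_nat; lia.
    (* Euclidean step for [a < b]: the chain is [a/(b-a)], [-(b-a)/a], [-b/a], [a/b]. *)
    have /KS/KB/KS : K (a%:R / (b - a)%:R) by apply: IH; lia.
    have -> : - (a%:R / (b - a)%:R)^-1 - 1 = - (a%:R / b%:R)^-1 :> rat.
      by rewrite natrB 1?ltnW //; field; rewrite b0' a0' ba0.
    rewrite invrN opprK invrK oppr_eq0 invr_eq0 !mulf_eq0 !invr_eq0.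
    rewrite (negPf a0') (negPf b0') pnatr_eq0 /=; apply=> //; lia.
  - have -> : a%:R / b%:R = (a - b)%:R / b%:R + 1 :> rat.
      by rewrite natrB 1?ltnW //; field.
    by apply/KD/IH; lia.
have Kpos' y : 0 < y -> K y.
  by move=> /QRational.posratP [a [c [a0 c0 ->]]]; apply: (Kpos (a + c)%N).
case: (ltgtP 0 x) => [/Kpos' //|x0|<- //].
have -> : x = - (- x^-1)^-1 by rewrite invrN invrK opprK.
apply: KS; first by rewrite oppr_eq0 invr_eq0 lt_eqF.
by apply: Kpos'; rewrite oppr_gt0 invr_lt0.
Qed.

Section QRationalJets.
Variables (R : realType) (M : nat).
Hypothesis M_gt0 : (0 < M)%N.
Let E := exp_poly R M.
Let inE (p : {poly rat}) : {poly R} := map_poly ratr p \Po E.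

Definition q_eval (x : rat) (h : R) : R :=
  ratfun_eval (odflt 0 (q_rational (Some x))) (expR h).

Definition q_jet (x : rat) : {poly R} :=
  \poly_(k < M) (k`!%:R^-1 * derive1n k (q_eval x) 0).

Let inE0 (p : {poly rat}) : (inE p).[0] = ratr p.[1].
Proof. by rewrite comp_exp_poly0 // -[1](rmorph1 (@ratr R)) horner_map. Qed.

Let inE0_neq0 (p : {poly rat}) : p.[1] != 0 -> (inE p).[0] != 0.
Proof. by rewrite inE0 fmorph_eq0. Qed.

(** This congruence characterizes the analytically defined jet, because the denominator is
    invertible modulo ['X ^+ M]. The functional equations of jets then follow by clearing
    denominators. *)
Lemma q_jet_quotient x n d : q_fraction x n d -> eq_modX M (q_jet x * inE d) (inE n).
Proof.
move=> [xE d1 n1].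
have [u [k uE]] := eq_modX_inv M (inE0_neq0 d1).
have sE : eq_modX M ((inE n * u) * inE d) (inE n).
  by exists (inE n * k); rewrite -mulrA [u * _]mulrC uE; ring.
suff [l ->] : eq_modX M (q_jet x) (inE n * u).
  by have [m mE] := sE; exists (m + l * inE d); rewrite mulrDl mE; ring.
have d1R : (map_poly ratr d : {poly R}).[1] != 0.
  by rewrite -[1](rmorph1 (@ratr R)) horner_map fmorph_eq0.
apply/eq_modXP => j jM; rewrite coef_poly jM.
rewrite -(mulKf (fact_neq0 R j) (inE n * u)`_j); congr (_ * _).
rewrite -(derive1n_quotient_expR jM d1R (eq_modX_leq jM sE)).
apply: near_eq_derive1n.
have := @near_horner_expR_neq0 R (map_poly ratr d) 0; rewrite expR0 => /(_ d1R).
by apply: filterS => h dh; rewrite /q_eval xE; apply: ratfun_evalE.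
Qed.

Lemma q_jet0 : eq_modX M (q_jet 0) 0.
Proof.
have := q_jet_quotient q_fraction0.
by rewrite /inE rmorph0 rmorph1 comp_poly0 comp_polyC mulr1.
Qed.

Let inEX : inE 'X = E.
Proof. by rewrite /inE map_polyX comp_polyX. Qed.

Let inEM p r : inE (p * r) = inE p * inE r.
Proof. by rewrite /inE rmorphM comp_polyM. Qed.

Let inED p r : inE (p + r) = inE p + inE r.
Proof. by rewrite /inE rmorphD comp_polyD. Qed.

Let inEN p : inE (- p) = - inE p.
Proof. by rewrite /inE rmorphN raddfN. Qed.

Lemma q_jetD1 x : eq_modX M (q_jet (x + 1)) (E * q_jet x + 1).
Proof.
have [n [d H]] := q_fraction_exists x; have [_ d1 _] := H.
apply: (eq_modX_cancel (inE0_neq0 d1)).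
have [k kE] := q_jet_quotient H; have [l lE] := q_jet_quotient (q_fractionD1 H).
rewrite inED inEM inEX in lE.
exists (l - E * k); rewrite lE mulrDl -mulrA kE; ring.
Qed.

Lemma q_jet_neginv x : x != 0 -> eq_modX M (E * q_jet x * q_jet (- x^-1)) (-1).
Proof.
move=> x0; have [n [d H]] := q_fraction_exists x; have [_ d1 _] := H.
apply: (eq_modX_cancel (inE0_neq0 d1)).
have [k kE] := q_jet_quotient H; have [l lE] := q_jet_quotient (q_fraction_neginv x0 H).
rewrite inEM inEN inEX in lE.
exists (l + E * q_jet (- x^-1) * k).
transitivity (E * q_jet (- x^-1) * (q_jet x * inE d)); first by ring.
rewrite kE.
transitivity (q_jet (- x^-1) * (E * inE n) + 'X ^+ M * (E * q_jet (- x^-1) * k)).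
  by ring.
by rewrite lE; ring.
Qed.

Lemma q_jet_cst x : (q_jet x)`_0 = ratr x.
Proof.
have [n [d H]] := q_fraction_exists x; have [_ d1 nE] := H.
have [k /(congr1 (horner^~ 0))] := q_jet_quotient H.
rewrite hornerD !hornerM !inE0 nE rmorphM horner_exp hornerX expr0n eqn0Ngt M_gt0.
by rewrite mul0r addr0 horner_coef0; apply: mulIf; rewrite fmorph_eq0.
Qed.

End QRationalJets.

(** * From [q]-rationals to cross-ratios *)

Lemma cross_ratio_oo01 (K : fieldType) (z : K) :
  cross_ratio None (Some 0) (Some 1) (Some z) = z.
Proof.
rewrite /cross_ratio !P1_lift_detE !mxE /= ?(mulr1, mulr0, mul0r, subr0, sub0r, mul1r).
by rewrite invrN invr1 mulrN1 opprK.
Qed.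

Lemma cr_q_q_rational x F : q_rational (Some x) = Some F ->
  cr_q None (Some 0) (Some 1) (Some x) = F.
Proof.
move=> xE; have f0 := q_rational0 q_rationalP.
have fI : q_rational None = None.
  have := q_rational_neginv q_rationalP (Some 0).
  by rewrite f0 /P1_neginv /P1_affine /omap /obind /oapp eqxx mulr0 addr0 eqxx.
have f1 : q_rational (Some 1) = Some 1.
  have := q_rationalD1 q_rationalP (Some 0).
  by rewrite f0 /P1_affine /omap /obind /oapp !mulr0 !add0r.
by rewrite /cr_q xE fI f0 f1 cross_ratio_oo01.
Qed.

Theorem theorem1p3 (R : realType) :
  alg_independent_seq
    (fun (n : nat) (X : quadruple) => (cr_taylor R n X)%:C : R[i]).
Proof.
move=> N [P [/eqP PN0 Pv]]; apply: PN0.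
pose M := N.+3; pose toC := map_poly (real_complex R).
(* The truncation of [(e^h - 1) / h], one term shorter than [exp_poly R M] so that ['X * bR + 1]
   equals it exactly. *)
pose bR : {poly R} := \poly_(k < M.-1) (k.+1`!%:R)^-1.
have qE : 'X * toC bR + 1 = toC (exp_poly R M).
  apply/polyP => k; rewrite coefD coefXM coef1 !coef_map !coef_poly.
  case: k => [|k] /=; first by rewrite add0r fact0 invr1 rmorph1.
  by rewrite addr0 ltnS.
apply: (@jets_alg_independent R[i] N M (toC bR) (fun x => toC (q_jet R M x))) => //.
- by rewrite horner_coef0 coef_map coef_poly /= invr1 rmorph1.
- by rewrite horner_coef0 coef_deriv coef_map coef_poly /= fmorphV rmorph_nat.
- lia.
- have := eq_modX_map (real_complex R) (q_jet0 R (isT : (0 < M)%N)).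
  by rewrite rmorph0.
- move=> x; rewrite qE.
  have := eq_modX_map (real_complex R) (q_jetD1 R (isT : (0 < M)%N) x).
  by rewrite rmorphD rmorphM rmorph1.
- move=> x x0; rewrite qE.
  have := eq_modX_map (real_complex R) (q_jet_neginv R (isT : (0 < M)%N) x0).
  by rewrite !rmorphM rmorphN rmorph1.
- by move=> x; rewrite coef_map q_jet_cst //= fmorph_rat.
move=> x x0 x1.
have [n [d [xE _ _]]] := q_fraction_exists x.
(* The restrictions [x != 0] and [x != 1] are exactly what makes the four points distinct. *)
have Xuniq : uniq [tuple None; Some 0; Some 1; Some x : P1 rat].
  by rewrite /= !inE /= !(inj_eq (@Some_inj _)) ![_ == x]eq_sym x0 x1.
have := Pv (exist (fun t : 4.-tuple (P1 rat) => uniq t) _ Xuniq).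
apply: etrans; apply: mpoly.meval_eq => i.
have iM : (i < M)%N by apply: leq_trans (ltn_ord i) _; rewrite /M; lia.
rewrite /jet_values coef_map coef_poly iM /= rmorphM fmorphV rmorph_nat.
rewrite mulVKf ?fact_neq0 // /cr_taylor /cr_quad !(tnth_nth None) /=.
by rewrite (cr_q_q_rational xE) /q_eval xE.
Qed.
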